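(* Let $p\in[1,\infty)\setminus\{2\}$ and let $\mathcal{G}$ and $\mathcal{H}$ be ample Weyl groupoids satisfying condition (W) (defined in the context; in particular, their unit spaces are compact). If there exists a unital contractive homomorphism $F^p_\lambda(\mathcal{G})\to F^p_\lambda(\mathcal{H})$ that is injective on $C(\mathcal{G}^{(0)})$, then there exists an injective group homomorphism $[\![\mathcal{G}]\!]\hookrightarrow[\![\mathcal{H}]\!]$.
   Context: A topological groupoid $\mathcal{G}$ is a small category with all morphisms invertible, with a locally compact topology making multiplication and inversion continuous, and with Hausdorff unit space $\mathcal{G}^{(0)}$. Range and domain are $\mathsf{r}(\gamma)=\gamma\gamma^{-1}$, $\mathsf{d}(\gamma)=\gamma^{-1}\gamma$; $\mathcal{G}x=\mathsf{d}^{-1}(\{x\})$, $x\mathcal{G}=\mathsf{r}^{-1}(\{x\})$, $x\mathcal{G}x=x\mathcal{G}\cap\mathcal{G}x$. It is étale if $\mathsf{r},\mathsf{d}$ are local homeomorphisms, effective if the interior of $\{\gamma:\mathsf{r}(\gamma)=\mathsf{d}(\gamma)\}$ equals $\mathcal{G}^{(0)}$, and ample if it is étale and its topology has a basis of compact open sets. A Weyl groupoid is an effective Hausdorff étale groupoid. An ample groupoid $\mathcal{G}$ with compact unit space $X$ satisfies condition (W) if $\mathcal{G}x\setminus x\mathcal{G}x\neq\emptyset$ for every $x\in X$. An open bisection is an open subset $S\subseteq\mathcal{G}$ on which $\mathsf{r}$ and $\mathsf{d}$ are injective; put $\alpha_S=\mathsf{r}|_S\circ(\mathsf{d}|_S)^{-1}\colon\mathsf{d}(S)\to\mathsf{r}(S)$.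 The topological full group is $[\![\mathcal{G}]\!]=\{\alpha_S: S \text{ an open bisection with } \mathsf{d}(S)=\mathsf{r}(S)=\mathcal{G}^{(0)}\}$, a group of homeomorphisms of $\mathcal{G}^{(0)}$. For a Hausdorff étale groupoid $\mathcal{G}$, $C_c(\mathcal{G})$ is an algebra under convolution $(f*g)(\gamma)=\sum_{\tau\in\mathsf{r}(\gamma)\mathcal{G}}f(\tau)g(\tau^{-1}\gamma)$. For $x\in\mathcal{G}^{(0)}$ let $\lambda_x\colon C_c(\mathcal{G})\to\mathcal{B}(\ell^p(\mathcal{G}x))$, $\lambda_x(f)\xi=f*\xi$. Then $F^p_\lambda(\mathcal{G})$ is the completion of $C_c(\mathcal{G})$ in the norm $\sup_x\|\lambda_x(f)\|$. It contains $C_0(\mathcal{G}^{(0)})$ isometrically (extension by zero), and is unital with unit $\mathbb{1}_{\mathcal{G}^{(0)}}$ when $\mathcal{G}^{(0)}$ is compact. *)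

(* Defs.v *)
From HB Require Import structures.
From mathcomp Require Import all_boot all_order all_algebra.
From mathcomp Require Import all_classical all_reals all_analysis.
From mathcomp Require Import complex.

Set Implicit Arguments.
Unset Strict Implicit.
Unset Printing Implicit Defensive.

Import Order.TTheory GRing.Theory Num.Theory.
Import numFieldNormedType.Exports.

Local Open Scope classical_set_scope.
Local Open Scope ring_scope.

(* Small categories with all morphisms invertible, presented by their arrows:
   objects are identified with identity arrows, and [gmul g h] is the composite
   of [g] and [h] when [gdom g = grng h] (its other values are irrelevant).
   [gunits] coerces to its subtype. *)
HB.mixin Record isGroupoid G := {
  gunits : set G;
  gdom : G -> gunits;
  grng : G -> gunits;
  gmul : G -> G -> G;
  ginv : G -> G;
  gdom_unit : forall x : gunits, gdom (set_val x) = x;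
  grng_unit : forall x : gunits, grng (set_val x) = x;
  gdom_mul : forall g h, gdom g = grng h -> gdom (gmul g h) = gdom h;
  grng_mul : forall g h, gdom g = grng h -> grng (gmul g h) = grng g;
  gmulA : forall g h k, gdom g = grng h -> gdom h = grng k ->
    gmul g (gmul h k) = gmul (gmul g h) k;
  gmul1g : forall g, gmul (set_val (grng g)) g = g;
  gmulg1 : forall g, gmul g (set_val (gdom g)) = g;
  gdom_inv : forall g, gdom (ginv g) = grng g;
  grng_inv : forall g, grng (ginv g) = gdom g;
  gmulgV : forall g, gmul g (ginv g) = set_val (grng g);
  gmulVg : forall g, gmul (ginv g) g = set_val (gdom g)
}.

#[short(type="groupoidType")]
HB.structure Definition Groupoid := {G of isGroupoid G}.

(* The unit space, with the topology induced by that of [G] when there is one *)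
Notation unit_space G := (set_type (@gunits G)).

HB.mixin Record Groupoid_isTopological G of Groupoid G & Topological G := {
  groupoid_locally_compact : locally_compact [set: G];
  gmul_continuous :
    {within [set gh : G * G | gdom gh.1 = grng gh.2],
      continuous (fun gh : G * G => gmul gh.1 gh.2)};
  ginv_continuous : continuous (@ginv G);
  unit_space_hausdorff : hausdorff_space (unit_space G)
}.

#[short(type="topGroupoidType")]
HB.structure Definition TopGroupoid :=
  {G of Groupoid G & Topological G & Groupoid_isTopological G}.

Definition homeomorphism_on (X Y : topologicalType) (U : set X) (V : set Y)
    (f : X -> Y) :=
  {within U, continuous f} /\ exists g : Y -> X,
  [/\ {within V, continuous g}, set_fun U V f, set_fun V U g,
      {in U, cancel f g} & {in V, cancel g f}].

Definition local_homeomorphism (X Y : topologicalType) (f : X -> Y) :=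
  forall x, exists U : set X,
    [/\ open U, U x, open (f @` U) & homeomorphism_on U (f @` U) f].

Definition etale (G : topGroupoidType) :=
  local_homeomorphism (@gdom G) /\ local_homeomorphism (@grng G).

Definition effective (G : topGroupoidType) :=
  interior [set g : G | grng g = gdom g] = @gunits G.

Definition ample (G : topGroupoidType) :=
  etale G /\ exists2 B : set (set G), basis B & B `<=` compact.

Definition weyl (G : topGroupoidType) :=
  [/\ effective G, hausdorff_space G & etale G].

Definition dfiber (G : groupoidType) (x : unit_space G) : set G :=
  [set g | gdom g = x].

Definition rfiber (G : groupoidType) (x : unit_space G) : set G :=
  [set g | grng g = x].

Definition isotropy (G : groupoidType) (x : unit_space G) : set G :=
  rfiber x `&` dfiber x.

Definition condition_W (G : topGroupoidType) :=
  [/\ ample G, compact [set: unit_space G] &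
      forall x : unit_space G, dfiber x `\` isotropy x !=set0].

Definition open_bisection (G : topGroupoidType) (S : set G) :=
  [/\ open S, set_inj S (@grng G) & set_inj S (@gdom G)].

(* For a bisection [S] with [gdom @` S = setT], the last clause says
   [a = r|_S \o (d|_S)^-1]. The group law is composition. *)
Definition full_group (G : topGroupoidType) :
    set (unit_space G -> unit_space G) :=
  [set a | exists S : set G,
    [/\ open_bisection S, @gdom G @` S = setT, @grng G @` S = setT &
        forall g, S g -> a (gdom g) = grng g]].

Section ConvolutionAlgebra.
Context {R : realType} (p : R) {G : topGroupoidType}.
Implicit Types f h xi : G -> R[i].

Definition Cc : set (G -> R[i]) :=
  [set f | continuous (f : G -> R[i]^o) /\ compact (closure [set g | f g != 0])].

(* When [G] is Hausdorff etale and [f] is in [Cc], only finitely many [t] in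
   the fiber satisfy [f t != 0], so the finitely supported sum is the genuine
   one, for an arbitrary [h]. *)
Definition convol f h : G -> R[i] :=
  fun g => \sum_(t \in rfiber (grng g)) f t * h (gmul (ginv t) g).

Definition lpnorm (x : unit_space G) xi : \bar R :=
  poweR (\esum_(g in dfiber x) (complex.Re `|xi g| `^ p)%:E) p^-1.

(* Elements of l^p(Gx) are represented by their extensions by zero to [G]. *)
Definition lp_space (x : unit_space G) : set (G -> R[i]) :=
  [set xi | (forall g, ~ dfiber x g -> xi g = 0) /\ (lpnorm x xi < +oo)%E].

Definition lambda (x : unit_space G) f : (G -> R[i]) -> (G -> R[i]) := convol f.

Definition lp_opnorm (x : unit_space G) (T : (G -> R[i]) -> (G -> R[i])) :
    \bar R :=
  ereal_sup
    [set lpnorm x (T xi) | xi in [set xi | lp_space x xi /\ (lpnorm x xi <= 1)%E]].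

(* Operator norms are nonnegative: the maximum with 0 only matters when the
   unit space is empty, as [ereal_sup set0 = -oo]. *)
Definition reduced_norm f : \bar R :=
  maxe 0%E (ereal_sup [set lp_opnorm x (lambda x f) | x in [set: unit_space G]]).

End ConvolutionAlgebra.

(* Not necessarily unital *)
HB.mixin Record hasBanachMul (K : numFieldType) A of CompleteNormedModule K A := {
  bmul : A -> A -> A;
  bmulA : associative bmul;
  bmulDl : left_distributive bmul +%R;
  bmulDr : right_distributive bmul +%R;
  bscaleAl : forall (k : K) (a b : A), k *: bmul a b = bmul (k *: a) b;
  bscaleAr : forall (k : K) (a b : A), k *: bmul a b = bmul a (k *: b);
  ler_normbM : forall a b : A, `|bmul a b| <= `|a| * `|b|
}.

#[short(type="banachAlgType")]
HB.structure Definition BanachAlgebra (K : numFieldType) :=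
  {A of CompleteNormedModule K A & hasBanachMul K A}.

(* [A], with [iota] on C_c(G), is F^p_lambda(G): a complete normed algebra
   containing C_c(G), with its reduced norm, as a dense subalgebra. This
   determines [A] up to a unique isometric isomorphism. The values of [iota]
   outside [Cc] are irrelevant. *)
Record is_Fp_lambda (R : realType) (p : R) (G : topGroupoidType)
    (A : banachAlgType R[i]) (iota : (G -> R[i]) -> A) : Prop := IsFpLambda {
  Fp_linear : forall (a : R[i]) f h, Cc f -> Cc h ->
    iota (fun g => a * f g + h g) = a *: iota f + iota h;
  Fp_mul : forall f h, Cc f -> Cc h -> iota (convol f h) = bmul (iota f) (iota h);
  Fp_isometric : forall f, Cc f ->
    (complex.Re `|iota f|)%:E = reduced_norm p f;
  Fp_dense : closure (iota @` Cc) = setT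
}.

(* Extension by zero of a function on the unit space *)
Definition ext0 (R : realType) (G : topGroupoidType)
    (f : unit_space G -> R[i]) : G -> R[i] := valL_ 0 f.

Section Homomorphisms.
Context {R : realType} {G H : topGroupoidType} {A B : banachAlgType R[i]}.
Variables (iA : (G -> R[i]) -> A) (iB : (H -> R[i]) -> B).
Variable phi : {linear A -> B}.

Definition algebra_hom := {morph phi : a b / bmul a b >-> bmul a b}.

Definition unital := phi (iA \1_(@gunits G)) = iB \1_(@gunits H).

Definition contractive := forall a, `|phi a| <= `|a|.

Definition injective_on_C := set_inj
  [set iA (ext0 f) | f in [set f | continuous (f : unit_space G -> R[i]^o)]] phi.

End Homomorphisms.

Definition full_group_embeds (G H : topGroupoidType) :=
  exists Phi : (unit_space G -> unit_space G) -> (unit_space H -> unit_space H),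
    [/\ set_fun (@full_group G) (@full_group H) Phi,
        {in @full_group G &, {morph Phi : a b / a \o b}} &
        set_inj (@full_group G) Phi].

(* Main.v *)
Require Import Defs.
From HB Require Import structures.
From mathcomp Require Import all_boot all_order all_algebra.
From mathcomp Require Import all_classical all_reals all_analysis.
From mathcomp Require Import complex ring lra.
Import Order.TTheory GRing.Theory Num.Theory.
Import numFieldNormedType.Exports.
Local Open Scope classical_set_scope.
Local Open Scope ring_scope.

Set Implicit Arguments.
Unset Strict Implicit.
Unset Printing Implicit Defensive.

(* Elements of F^p_lambda(H) are functions on H (their matrix coefficients).
   For p <> 2, Clarkson's inequality and the Banach-Lamperti argument show that
   the coefficient function of an invertible isometry is supported on an open
   bisection with full domain and range, which thus defines an element of the
   full group of H. A full bisection S of G gives the invertible isometry 1_S,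
   whose image under phi is again one; this is the homomorphism of full groups.
   If phi(1_S) and phi(1_T) induce the same map, effectiveness puts the support
   of b = phi(1_T)^-1 phi(1_S) in the unit space. For W a clopen set of units
   phi(1_W) is supported there too, so it commutes with b. Hence
   phi(1_S 1_W 1_S^-1) = phi(1_T 1_W 1_T^-1), and as phi is injective on
   C(G^(0)), S and T move W to the same set. *)

(** The completion is given only as a Banach algebra in which C_c is dense with the reduced norm, so
    its elements do not come as operators on l^p(Gx). The substitute is the column of [b] at x, that
    is [coef b] restricted to the fibre Gx: its l^p norm is at most the norm of [b], left
    multiplication by [b] acts on columns with at most that norm, and the columns together determine
    [b]. An invertible isometry is encoded as a pair of mutually inverse elements of norm at most 1,
    which unital contractive homomorphisms visibly preserve. The projection 1_W is not of this kind,
    so its image e is controlled through 1 - 2e and 1 + (i - 1)e. A nonzero coefficient of e at a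
    non-unit g would make the coefficients of both vanish at the unit d(g), and e would have to take
    there the values 1/2 and (1 + i)/2 at once. *)

Definition nrm {R : realType} {V : normedZmodType R[i]} (v : V) : R :=
  complex.Re `|v|.

(** * Real-valued norms over the complex numbers *)

Section Nrm.
Context {R : realType}.

(** Norms over [R[i]] are complex numbers with zero imaginary part; passing to [R] makes real powers
    and linear arithmetic available. *)
Lemma nrmE (V : normedZmodType R[i]) (v : V) : `|v| = (nrm v)%:C%C.
Proof. by rewrite /nrm RRe_real// ger0_real. Qed.

Lemma nrm_ge0 (V : normedZmodType R[i]) (v : V) : 0 <= nrm v.
Proof. by rewrite -ler0c -nrmE. Qed.

Lemma nrm0 (V : normedZmodType R[i]) : nrm (0 : V) = 0.
Proof. by rewrite /nrm normr0. Qed.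

Lemma nrm0_eq0 (V : normedZmodType R[i]) (v : V) : nrm v = 0 -> v = 0.
Proof. by move=> v0; apply: normr0_eq0; rewrite nrmE v0. Qed.

Lemma nrm_gt0 (V : normedZmodType R[i]) (v : V) : (0 < nrm v) = (v != 0).
Proof.
rewrite lt_neqAle nrm_ge0 andbT eq_sym; congr (~~ _); apply/eqP/eqP.
  exact: nrm0_eq0.
by move=> ->; exact: nrm0.
Qed.

Lemma nrmN (V : normedZmodType R[i]) (v : V) : nrm (- v) = nrm v.
Proof. by rewrite /nrm normrN. Qed.

Lemma nrmBC (V : normedZmodType R[i]) (u v : V) : nrm (u - v) = nrm (v - u).
Proof. by rewrite -nrmN opprB. Qed.

Lemma ler_nrmD (V : normedZmodType R[i]) (u v : V) :
  nrm (u + v) <= nrm u + nrm v.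
Proof. by rewrite -lecR rmorphD /= -!nrmE ler_normD. Qed.

Lemma ler_nrm_distD (V : normedZmodType R[i]) (w u v : V) :
  nrm (u - v) <= nrm (u - w) + nrm (w - v).
Proof. by rewrite (le_trans _ (ler_nrmD _ _))// addrA subrK. Qed.

Lemma nrmM (a b : R[i]) : nrm (a * b) = nrm a * nrm b.
Proof. by apply: complexI; rewrite rmorphM /= -!nrmE normrM. Qed.

Lemma nrm1 : nrm (1 : R[i]) = 1.
Proof. by rewrite /nrm normr1. Qed.

Lemma nrmc (a : R) : nrm (a%:C%C) = `|a|.
Proof. by rewrite /nrm normc_def /= expr0n addr0 sqrtr_sqr. Qed.

Lemma nrmZ (V : normedModType R[i]) (a : R[i]) (v : V) :
  nrm (a *: v) = nrm a * nrm v.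
Proof. by apply: complexI; rewrite rmorphM /= -!nrmE normrZ. Qed.

Lemma nrm_sqr (a : R[i]) : nrm a ^+ 2 = complex.Re a ^+ 2 + complex.Im a ^+ 2.
Proof. by rewrite /nrm normc_def /= sqr_sqrtr// addr_ge0// sqr_ge0. Qed.

Lemma nrm_Re_Im (a : R[i]) : nrm a <= `|complex.Re a| + `|complex.Im a|.
Proof.
rewrite -(@ler_pXn2r _ 2)// ?nnegrE ?nrm_ge0 ?addr_ge0//.
by rewrite nrm_sqr sqrrD !real_normK ?num_real// lerD2r lerDl mulrn_wge0 ?mulr_ge0.
Qed.

Lemma Re_nrm (a : R[i]) : `|complex.Re a| <= nrm a.
Proof.
rewrite -(@ler_pXn2r _ 2)// ?nnegrE ?nrm_ge0//.
by rewrite nrm_sqr real_normK ?num_real// lerDl sqr_ge0.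
Qed.

Lemma Im_nrm (a : R[i]) : `|complex.Im a| <= nrm a.
Proof.
rewrite -(@ler_pXn2r _ 2)// ?nnegrE ?nrm_ge0//.
by rewrite nrm_sqr real_normK ?num_real// lerDr sqr_ge0.
Qed.

(** This is how identities pass from C_c to the completion: both sides are approximated with an
    error proportional to [e]. *)
Lemma eq_nrm_le (V : normedZmodType R[i]) (M : R) (u v : V) :
  (forall e, 0 < e -> nrm (u - v) <= M * e) -> u = v.
Proof.
move=> h; apply/eqP; rewrite -subr_eq0; apply/negPn/negP; rewrite -nrm_gt0 => uv0.
have M1 : 0 < `|M| + 1 by rewrite ltr_wpDl.
have := h _ (divr_gt0 uv0 M1); apply/negP; rewrite -ltNge mulrCA gtr_pMr//.
by rewrite ltr_pdivrMr// mul1r (le_lt_trans (ler_norm _))// ltrDl.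
Qed.

End Nrm.

(** * Convexity and superadditivity of real powers *)

Section PowR.
Context {R : realType}.
Implicit Types (s t x y q p : R).

Lemma powR_le_convex q t x y : 1 <= q -> 0 <= t -> t <= 1 -> 0 <= x -> 0 <= y ->
  (t * x + (1 - t) * y) `^ q <= t * x `^ q + (1 - t) * y `^ q.
Proof.
move=> q1 t0 t1 x0 y0.
have := @convex_powR R q q1 (Itv01 t0 t1) x y; rewrite !convRE/=; apply.
  by rewrite inE/= in_itv/= x0.
by rewrite inE/= in_itv/= y0.
Qed.

Lemma powR_le_half q x y : 1 <= q -> 0 <= x -> 0 <= y ->
  ((x + y) / 2) `^ q <= (x `^ q + y `^ q) / 2.
Proof.
move=> q1 x0 y0.
have := @powR_le_convex q 2^-1 x y q1 ltac:(lra) ltac:(lra) x0 y0.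
have -> : 1 - 2^-1 = 2^-1 :> R by lra.
by rewrite -!mulrDr mulrC (mulrC 2^-1).
Qed.

(** Convexity for the exponent 1/q >= 1, applied to x^q and y^q, is concavity for q. *)
Lemma powR_ge_half q x y : 0 < q -> q <= 1 -> 0 <= x -> 0 <= y ->
  (x `^ q + y `^ q) / 2 <= ((x + y) / 2) `^ q.
Proof.
move=> q0 q1 x0 y0.
have qV1 : 1 <= q^-1 by rewrite invf_ge1.
have qK z : 0 <= z -> (z `^ q) `^ q^-1 = z.
  by move=> z0; rewrite -powRrM divff ?gt_eqF// powRr1.
have := @powR_le_half q^-1 (x `^ q) (y `^ q) qV1 (powR_ge0 _ _) (powR_ge0 _ _).
rewrite !qK// => h.
have := ge0_ler_powR (ltW q0) _ _ h.
rewrite -powRrM mulVf ?gt_eqF// powRr1 ?divr_ge0 ?addr_ge0 ?powR_ge0//.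
by apply; rewrite nnegrE ?powR_ge0 ?divr_ge0 ?addr_ge0.
Qed.

(** Write (s + t)^q = s (s + t)^(q-1) + t (s + t)^(q-1); as q - 1 < 0, enlarging the base from s or
    t to s + t makes each factor strictly smaller. *)
Lemma powR_lt_add q s t : 0 < q -> q < 1 -> 0 < s -> 0 < t ->
  (s + t) `^ q < s `^ q + t `^ q.
Proof.
move=> q0 q1 s0 t0.
have h z w : 0 < z -> 0 < w -> z * (z + w) `^ (q - 1) < z `^ q.
  move=> z0 w0; rewrite -(@mulr_powRB1 R z q) ?(ltW z0)// ltr_pM2l//.
  rewrite -(opprB 1 q) !powRN ltf_pV2 ?posrE ?powR_gt0 ?addr_gt0//.
  by apply: gt0_ltr_powR; rewrite ?nnegrE ?subr_gt0 ?addr_ge0 ?ltW ?ltrDl.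
rewrite -(@mulr_powRB1 R (s + t) q) ?addr_ge0 ?ltW// mulrDl ltrD ?h//.
by rewrite addrC h.
Qed.

Lemma powR_gt_add q s t : 1 < q -> 0 < s -> 0 < t ->
  s `^ q + t `^ q < (s + t) `^ q.
Proof.
move=> q1 s0 t0; have q0 : 0 < q by rewrite (lt_trans _ q1).
have h z w : 0 < z -> 0 < w -> z `^ q < z * (z + w) `^ (q - 1).
  move=> z0 w0; rewrite -(@mulr_powRB1 R z q) ?(ltW z0)// ltr_pM2l//.
  by apply: gt0_ltr_powR; rewrite ?nnegrE ?subr_gt0 ?addr_ge0 ?ltW ?ltrDl.
rewrite -(@mulr_powRB1 R (s + t) q) ?addr_ge0 ?ltW// mulrDl ltrD ?h//.
by rewrite (addrC s) h.
Qed.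

End PowR.

(** * Clarkson's inequality for complex scalars, with its equality case *)

Section Clarkson.
Context {R : realType} (p : R).
Implicit Types a b : R[i].

Definition clark_sum a b : R := nrm (a + b) `^ p + nrm (a - b) `^ p.
Definition clark_dbl a b : R := 2 * (nrm a `^ p + nrm b `^ p).

Let sq a : R := nrm a ^+ 2.

Let sq_ge0 a : 0 <= sq a.
Proof. by rewrite /sq sqr_ge0. Qed.

(** Reading |a|^p as (|a|^2)^(p/2) lets the parallelogram law enter; the exponent p/2 is then
    concave or convex according to the side of 2 on which p lies. *)
Let nrm_powR a : nrm a `^ p = sq a `^ (p / 2).
Proof.
rewrite /sq -powR_mulrn ?nrm_ge0// -powRrM; congr (_ `^ _).
by rewrite mulrCA divff ?mulr1// pnatr_eq0.
Qed.

Let parallelogram a b : (sq (a + b) + sq (a - b)) / 2 = sq a + sq b.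
Proof.
case: a b => a1 a2 [b1 b2]; rewrite /sq !nrm_sqr/=.
apply: (canLR (mulfK _)); first by rewrite pnatr_eq0.
ring.
Qed.

Lemma clarkson_disjoint a b : a = 0 \/ b = 0 -> 0 < p ->
  clark_sum a b = clark_dbl a b.
Proof.
move=> h p0; rewrite /clark_sum /clark_dbl.
have P0 : (0 : R) `^ p = 0 by rewrite powR0// gt_eqF.
by case: h => ->; rewrite ?add0r ?addr0 ?sub0r ?subr0 ?nrmN nrm0 P0;
   rewrite ?add0r ?addr0 mulr2n mulrDl mul1r.
Qed.

(** Midpoint concavity of the power p/2 with the parallelogram law bounds the sum by 2 (|a|^2 +
    |b|^2)^(p/2), and subadditivity of that power finishes. The second step is strict unless a or b
    is zero, which gives the equality case. For p > 2 both steps reverse. *)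
Lemma clarkson_lt2 a b : 0 < p -> p < 2 -> clark_sum a b <= clark_dbl a b.
Proof.
move=> p0 p2; have q0 : 0 < p / 2 by rewrite divr_gt0.
have q1 : p / 2 < 1 by rewrite ltr_pdivrMr// mul1r.
rewrite /clark_sum /clark_dbl !nrm_powR.
have := powR_ge_half q0 (ltW q1) (sq_ge0 (a + b)) (sq_ge0 (a - b)).
rewrite ler_pdivrMr// parallelogram [_ * 2]mulrC => /le_trans; apply.
rewrite ler_pM2l//.
have [a0|a0] := eqVneq (sq a) 0.
  by rewrite a0 add0r lerDr powR_ge0.
have [b0|b0] := eqVneq (sq b) 0.
  by rewrite b0 addr0 lerDl powR_ge0.
by apply/ltW/powR_lt_add => //; rewrite lt_neqAle eq_sym ?a0 ?b0/=.
Qed.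

Lemma clarkson_lt2_eq a b : 0 < p -> p < 2 ->
  clark_sum a b = clark_dbl a b -> a = 0 \/ b = 0.
Proof.
move=> p0 p2; have q0 : 0 < p / 2 by rewrite divr_gt0.
have q1 : p / 2 < 1 by rewrite ltr_pdivrMr// mul1r.
have [->|a0] := eqVneq a 0; first by left.
have [->|b0] := eqVneq b 0; first by right.
rewrite /clark_sum /clark_dbl !nrm_powR => h; exfalso.
have := powR_ge_half q0 (ltW q1) (sq_ge0 (a + b)) (sq_ge0 (a - b)).
rewrite ler_pdivrMr// parallelogram [_ * 2]mulrC {}h ler_pM2l//.
by apply/negP; rewrite -ltNge powR_lt_add// exprn_gt0// nrm_gt0.
Qed.

Lemma clarkson_gt2 a b : 2 < p -> clark_dbl a b <= clark_sum a b.
Proof.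
move=> p2; have q1 : 1 < p / 2 by rewrite ltr_pdivlMr// mul1r.
rewrite /clark_sum /clark_dbl !nrm_powR.
have := powR_le_half (ltW q1) (sq_ge0 (a + b)) (sq_ge0 (a - b)).
rewrite ler_pdivlMr// parallelogram [_ * 2]mulrC; apply: le_trans.
rewrite ler_pM2l//.
have P0 : (0 : R) `^ (p / 2) = 0 by rewrite powR0// gt_eqF// (lt_trans _ q1).
have [a0|a0] := eqVneq (sq a) 0.
  by rewrite a0 !add0r P0 add0r.
have [b0|b0] := eqVneq (sq b) 0.
  by rewrite b0 !addr0 P0 addr0.
by apply/ltW/powR_gt_add => //; rewrite lt_neqAle eq_sym ?a0 ?b0/=.
Qed.

Lemma clarkson_gt2_eq a b : 2 < p ->
  clark_sum a b = clark_dbl a b -> a = 0 \/ b = 0.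
Proof.
move=> p2; have q1 : 1 < p / 2 by rewrite ltr_pdivlMr// mul1r.
have [->|a0] := eqVneq a 0; first by left.
have [->|b0] := eqVneq b 0; first by right.
rewrite /clark_sum /clark_dbl !nrm_powR => h; exfalso.
have := powR_le_half (ltW q1) (sq_ge0 (a + b)) (sq_ge0 (a - b)).
rewrite ler_pdivlMr// parallelogram [_ * 2]mulrC {}h ler_pM2l//.
by apply/negP; rewrite -ltNge powR_gt_add// exprn_gt0// nrm_gt0.
Qed.

End Clarkson.

(** * l^p sums: Minkowski, limits, and disjoint supports *)

Section Psum.
Context {R : realType} {T : choiceType} (p : R).
Hypothesis p1 : 1 <= p.
Implicit Types (D : set T) (xi eta : T -> R[i]) (r : seq T) (a b c m : R).

Definition psum D xi : \bar R := \esum_(g in D) (nrm (xi g) `^ p)%:E.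

(* For [0 <= c]: the norm of [xi] in l^p(D) is at most [c]. *)
Definition ple D xi c := (psum D xi <= (c `^ p)%:E)%E.

Let p_gt0 : 0 < p. Proof. by rewrite (lt_le_trans _ p1). Qed.
Let p_neq0 : p != 0. Proof. by rewrite gt_eqF. Qed.
Let pow0 : (0 : R) `^ p = 0. Proof. by rewrite powR0. Qed.

Lemma pleP D xi c : ple D xi c <-> forall r, uniq r -> (forall t, t \in r -> D t) ->
  \sum_(t <- r) nrm (xi t) `^ p <= c `^ p.
Proof.
split=> [h r ur rD|h].
  rewrite -lee_fin; apply: le_trans h; apply: esum_ge; exists [set` r].
    by split => // t /rD.
  by rewrite -fsbig_seq// sumEFin.
apply: ge_ereal_sup => _ [X [finX XD] <-].
rewrite fsbig_finite//= sumEFin lee_fin h// => t.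
by rewrite in_fset_set// inE => /XD.
Qed.

Lemma ple_nrm_le D xi c t : ple D xi c -> 0 <= c -> D t -> nrm (xi t) <= c.
Proof.
move=> /pleP h c0 Dt; have := h [:: t] isT.
rewrite big_seq1 leNgt => H; rewrite leNgt; apply/negP => cx.
have /negP := H ltac:(by move=> s; rewrite inE => /eqP ->); apply.
by apply: gt0_ltr_powR; rewrite ?nnegrE ?nrm_ge0.
Qed.

Lemma ple0 D xi t : ple D xi 0 -> D t -> xi t = 0.
Proof.
move=> h Dt; apply: nrm0_eq0; apply/eqP; rewrite eq_le nrm_ge0 andbT.
exact: ple_nrm_le h _ Dt.
Qed.

Lemma psum_eq0 D xi : (forall t, D t -> xi t = 0) -> psum D xi = 0%E.
Proof. by move=> h; apply: esum1 => t /h ->; rewrite nrm0 pow0. Qed.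

Lemma eq_psum D xi eta : (forall t, D t -> nrm (xi t) = nrm (eta t)) ->
  psum D xi = psum D eta.
Proof. by move=> h; apply: eq_esum => t /h ->. Qed.

Lemma ple_eq D xi eta c : (forall t, D t -> xi t = eta t) ->
  ple D xi c -> ple D eta c.
Proof. by move=> h; rewrite /ple (@eq_psum _ xi eta)// => t /h ->. Qed.

Lemma ple_le D xi a b : 0 <= a -> a <= b -> ple D xi a -> ple D xi b.
Proof.
move=> a0 ab /le_trans; apply; rewrite lee_fin.
by apply: ge0_ler_powR; rewrite ?nnegrE// ?(le_trans _ ab)// ltW.
Qed.

Let powR_div x y : 0 <= x -> 0 < y -> x `^ p / y `^ p = (x / y) `^ p.
Proof.
move=> x0 y0; have yn0 : y != 0 by rewrite gt_eqF.
have -> : x `^ p = (x / y) `^ p * y `^ p.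
  by rewrite -powRM ?divfK// ?divr_ge0// ltW.
by rewrite mulfK// gt_eqF// powR_gt0.
Qed.

(** Convexity of the power p at x/a and y/b with weights a/(a + b) and b/(a + b). Summed over the
    index set, the right-hand side becomes at most (a + b)^p, which is Minkowski's inequality. *)
Let powR_addterm a b x y : 0 < a -> 0 < b -> 0 <= x -> 0 <= y ->
  (x + y) `^ p <= (a + b) `^ p *
    (a / (a + b) * (x `^ p / a `^ p) + b / (a + b) * (y `^ p / b `^ p)).
Proof.
move=> a0 b0 x0 y0; have ab : 0 < a + b by rewrite addr_gt0.
have w1 : 0 <= 1 - a / (a + b) by rewrite subr_ge0 ler_pdivrMr// mul1r lerDl ltW.
have e : x + y = (a + b) * (a / (a + b) * (x / a) + (1 - a / (a + b)) * (y / b)).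
  by field; rewrite !gt_eqF.
rewrite e powRM ?(ltW ab)//; last first.
  have ha := ltW a0; have hb := ltW b0; have hab := ltW ab.
  apply: addr_ge0; apply: mulr_ge0.
  - exact: divr_ge0.
  - exact: divr_ge0.
  - exact: w1.
  - exact: divr_ge0.
rewrite ler_pM2l ?powR_gt0//.
have -> : x `^ p / a `^ p = (x / a) `^ p.
  exact: powR_div.
have -> : y `^ p / b `^ p = (y / b) `^ p.
  exact: powR_div.
have -> : b / (a + b) = 1 - a / (a + b) by field; rewrite gt_eqF.
have ha := ltW a0; have hb := ltW b0; have hab := ltW ab.
apply: powR_le_convex => //; rewrite ?divr_ge0//.
by rewrite -subr_ge0.
Qed.

Let sum0 r (f : T -> R) t : (forall t, 0 <= f t) -> \sum_(t <- r) f t `^ p <= 0 `^ p ->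
  t \in r -> f t = 0.
Proof.
rewrite pow0 => f0; elim: r => //= s r ih; rewrite big_cons inE => h.
have s0 : 0 <= \sum_(j <- r) f j `^ p by rewrite sumr_ge0// => *; rewrite powR_ge0.
have := powR_ge0 (f s) p => fs0.
move=> /orP[/eqP ->|]; last by apply: ih; rewrite (le_trans _ h)// lerDr.
by apply/eqP; have := powR_eq0 (f s) p; rewrite p_neq0 andbT => <-; lra.
Qed.

Lemma minkowski_sum r (f h : T -> R) a b : (forall t, 0 <= f t) ->
    (forall t, 0 <= h t) -> 0 <= a -> 0 <= b ->
    \sum_(t <- r) f t `^ p <= a `^ p -> \sum_(t <- r) h t `^ p <= b `^ p ->
  \sum_(t <- r) (f t + h t) `^ p <= (a + b) `^ p.
Proof.
move=> f0 h0; rewrite le_eqVlt => /predU1P[<- _ fa hb|a0].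
  rewrite add0r (le_trans _ hb)// big_seq [leRHS]big_seq ler_sum// => t tr.
  by rewrite (sum0 f0 fa tr) add0r.
rewrite le_eqVlt => /predU1P[<- fa hb|b0 fa hb].
  rewrite addr0 (le_trans _ fa)// big_seq [leRHS]big_seq ler_sum// => t tr.
  by rewrite (sum0 h0 hb tr) addr0.
apply: le_trans (ler_sum _ (fun t _ => powR_addterm a0 b0 (f0 t) (h0 t))) _.
rewrite -mulr_sumr ger_pMr ?powR_gt0 ?addr_gt0//.
rewrite big_split/= -!mulr_sumr -!mulr_suml.
have h1 : a / (a + b) + b / (a + b) = 1 by rewrite -mulrDl divff// gt_eqF// addr_gt0.
have a0' := ltW a0; have b0' := ltW b0; have ab0 := addr_ge0 a0' b0'.
rewrite -h1; apply: lerD; apply: ler_piMr.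
- exact: divr_ge0.
- by rewrite ler_pdivrMr ?powR_gt0// mul1r.
- exact: divr_ge0.
- by rewrite ler_pdivrMr ?powR_gt0// mul1r.
Qed.

Lemma pleD D xi eta a b : 0 <= a -> 0 <= b -> ple D xi a -> ple D eta b ->
  ple D (fun t => xi t + eta t) (a + b).
Proof.
move=> a0 b0 /pleP ha /pleP hb; apply/pleP => r ur rD.
apply: le_trans (minkowski_sum _ _ a0 b0 (ha r ur rD) (hb r ur rD)).
- apply: ler_sum => t _; apply: ge0_ler_powR (ler_nrmD _ _).
  + exact: ltW.
  + by rewrite nnegrE nrm_ge0.
  + by rewrite nnegrE addr_ge0 ?nrm_ge0.
- by move=> t; apply: nrm_ge0.
- by move=> t; apply: nrm_ge0.
Qed.

Lemma pleZ D xi a k : 0 <= a -> ple D xi a -> ple D (fun t => k * xi t) (nrm k * a).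
Proof.
move=> a0 /pleP h; apply/pleP => r ur rD.
under eq_bigr do rewrite nrmM powRM ?nrm_ge0//.
by rewrite -mulr_sumr powRM ?nrm_ge0// ler_wpM2l ?powR_ge0 ?h.
Qed.

(** Closed balls of l^p are closed even for uniform convergence: only finitely many terms matter at
    a time, and on those uniform errors are small in l^p. *)
Lemma ple_closed D xi c M : 0 <= c -> 0 <= M ->
  (forall e, 0 < e -> exists2 eta, forall t, D t -> nrm (xi t - eta t) <= M * e &
     ple D eta (c + M * e)) -> ple D xi c.
Proof.
move=> c0 M0 h; apply/pleP => r ur rD.
set S := (X in X <= _); have S0 : 0 <= S by rewrite sumr_ge0// => *; rewrite powR_ge0.
(* [n] is the l^p norm of the constant 1 on [r], so a pointwise error [M * e] costs [M * e * n]; [r]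
   stays fixed while [e] tends to 0. *)
pose n : R := ((size r)%:R : R) `^ p^-1.
have np : n `^ p = (size r)%:R by rewrite -powRrM mulVf// powRr1.
have n0 : 0 <= n by rewrite powR_ge0.
suff H : forall e, 0 < e -> S <= (c + (M + M * n) * e) `^ p.
  have H' : S `^ p^-1 <= c.
    apply/ler_addgt0Pr => e e0.
    have K0 : 0 < M + M * n + 1 by rewrite ltr_wpDl// addr_ge0// mulr_ge0.
    have := H _ (divr_gt0 e0 K0).
    have d0 : 0 <= c + (M + M * n) * (e / (M + M * n + 1)).
      apply: addr_ge0 => //; apply: mulr_ge0; first exact: addr_ge0 (mulr_ge0 _ _).
      by apply: divr_ge0; apply: ltW.
    have pV0 : 0 <= p^-1 by rewrite invr_ge0 ltW.
    move=> /(ge0_ler_powR pV0); rewrite !nnegrE S0 powR_ge0 => /(_ isT isT).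
    rewrite -powRrM divff// powRr1// => /le_trans; apply.
    rewrite lerD2l mulrCA ger_pMr// ler_pdivrMr// mul1r; lra.
  have pp0 : 0 <= p by exact: ltW.
  have := ge0_ler_powR pp0 _ _ H'; rewrite -powRrM mulVf// powRr1//.
  by apply; rewrite nnegrE// powR_ge0.
move=> e e0; have [eta h1 /pleP h2] := h _ e0.
have M2 : 0 <= M * e by rewrite mulr_ge0// ltW.
have -> : c + (M + M * n) * e = M * e * n + (c + M * e) by ring.
have hA : \sum_(t <- r) (fun t => if t \in r then M * e else 0) t `^ p <= (M * e * n) `^ p.
  rewrite powRM// np big_seq.
  under eq_bigr => t tr do rewrite tr.
  by rewrite -big_seq big_const_seq iter_addr_0 count_predT mulr_natr.
have := minkowski_sum _ _ _ _ hA (h2 r ur rD) => H.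
apply: le_trans (H _ _ _ _) => //.
- rewrite /S big_seq [leRHS]big_seq; apply: ler_sum => t tr; rewrite tr.
  apply: ge0_ler_powR.
  + exact: ltW.
  + by rewrite nnegrE nrm_ge0.
  + by rewrite nnegrE addr_ge0 ?nrm_ge0.
  + rewrite -[X in nrm X](subrK (eta t)) (le_trans (ler_nrmD _ _))// lerD2r.
    by rewrite h1//; apply: rD.
- by move=> t; case: ifP.
- by move=> t; apply: nrm_ge0.
- by rewrite mulr_ge0.
- by rewrite addr_ge0.
Qed.

Lemma ple_set1 D xi x c : 0 <= c -> (forall t, D t -> t != x -> xi t = 0) ->
  (D x -> nrm (xi x) <= c) -> ple D xi c.
Proof.
move=> c0 xi0 xic; have cp0 := powR_ge0 c p.
apply/pleP => r ur rD; have [xr|xr] := boolP (x \in r); last first.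
  rewrite big1_seq// => t /= tr; rewrite xi0 ?nrm0 ?pow0//; first exact: rD.
  by apply: contraNneq xr => <-.
rewrite (bigD1_seq x)//= big1_seq ?addr0 => [|t /= /andP[tx tr]]; last first.
  by rewrite xi0 ?nrm0 ?pow0//; exact: rD.
have := xic (rD _ xr) => h.
by apply: ge0_ler_powR; rewrite ?nnegrE ?nrm_ge0// ltW.
Qed.

(** The sum of [h] is that of [f] plus that of [h - f]; finiteness allows cancelling, so the
    nonnegative terms [h t - f t] sum to 0. *)
Lemma eq_psum_le D (f h : T -> R) : (forall t, D t -> 0 <= f t) ->
    (forall t, D t -> f t <= h t) ->
    (\esum_(t in D) (h t)%:E < +oo)%E ->
    \esum_(t in D) (f t)%:E = \esum_(t in D) (h t)%:E ->
  forall t, D t -> f t = h t.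
Proof.
move=> f0 fh hoo e.
have e1 : (\esum_(t in D) (h t)%:E =
    \esum_(t in D) (f t)%:E + \esum_(t in D) (h t - f t)%:E)%E.
  rewrite -esumD => [|t Dt|t Dt]; rewrite ?lee_fin ?f0 ?subr_ge0 ?fh//.
  by apply: eq_esum => t Dt; rewrite -EFinD addrCA subrr addr0.
have foo : (\esum_(t in D) (f t)%:E \is a fin_num)%E.
  by rewrite ge0_fin_numE ?e// esum_ge0// => t Dt; rewrite lee_fin (le_trans _ (fh _ _)) ?f0.
have d0 : (0 <= \esum_(t in D) (h t - f t)%:E)%E.
  by apply: esum_ge0 => t Dt; rewrite lee_fin subr_ge0 fh.
have dE : (\esum_(t in D) (h t - f t)%:E = 0)%E.
  move: e1 d0 foo; rewrite -e.
  move: (\esum_(t in D) (f t)%:E)%E (\esum_(t in D) (h t - f t)%:E)%E => [x| |] [y| |]//.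
  by move=> /eqP; rewrite eqe -subr_eq0 opprD addrA subrr add0r oppr_eq0 => /eqP ->.
move=> t Dt; apply/eqP; rewrite eq_le fh//= -subr_le0.
suff : ((h t - f t)%:E <= 0)%E by rewrite lee_fin.
rewrite -{}dE; apply: esum_ge; exists [set t]; first by split=> // _ ->.
by rewrite fsbig_set1.
Qed.

Let psum_fin D xi c : ple D xi c -> (psum D xi < +oo)%E.
Proof. by move=> /le_lt_trans; apply; rewrite ltry. Qed.

Let esum_clark_sum D xi eta :
  (psum D (fun t => xi t + eta t)%R + psum D (fun t => xi t - eta t)%R =
   \esum_(t in D) (clark_sum p (xi t) (eta t))%:E)%E.
Proof. by rewrite /psum -esumD// => t _; rewrite lee_fin powR_ge0. Qed.

Let esum_clark_dbl D xi eta :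
  ((psum D xi + psum D eta) + (psum D xi + psum D eta) =
   \esum_(t in D) (clark_dbl p (xi t) (eta t))%:E)%E.
Proof.
rewrite /psum -!esumD.
- by apply: eq_esum => t _; rewrite -!EFinD /clark_dbl mulr2n mulrDl mul1r.
- by move=> t _; rewrite lee_fin addr_ge0 ?powR_ge0.
- by move=> t _; rewrite lee_fin addr_ge0 ?powR_ge0.
- by move=> t _; rewrite lee_fin powR_ge0.
- by move=> t _; rewrite lee_fin powR_ge0.
Qed.

(** For a given p the scalar inequality has the same direction at every index, so equality of the
    finite totals forces equality at each index. The bounds [a] and [b] serve to make the totals
    finite. *)
Lemma disjoint_of_clarkson D xi eta a b : p != 2 -> ple D xi a -> ple D eta b ->
    (psum D (fun t => xi t + eta t)%R + psum D (fun t => xi t - eta t)%R =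
      (psum D xi + psum D eta) + (psum D xi + psum D eta))%E ->
  forall t, D t -> xi t = 0 \/ eta t = 0.
Proof.
move=> p2 /psum_fin hxi /psum_fin heta e.
have fin : ((psum D xi + psum D eta) + (psum D xi + psum D eta) < +oo)%E.
  by rewrite !lte_add_pinfty.
have s0 u v : 0 <= clark_sum p u v by rewrite addr_ge0 ?powR_ge0.
have d0 u v : 0 <= clark_dbl p u v by rewrite mulr_ge0 ?addr_ge0 ?powR_ge0.
move: e (fin); rewrite esum_clark_dbl esum_clark_sum => e {}fin t Dt.
move: p2; rewrite neq_lt => /orP[] p2.
  apply: (clarkson_lt2_eq p_gt0 p2).
  apply: eq_psum_le fin e t Dt => t Dt; first exact: s0.
  exact: clarkson_lt2.
apply: (clarkson_gt2_eq p2); apply/esym.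
move: e fin => /esym e; rewrite e => fin.
apply: eq_psum_le fin e t Dt => t Dt; first exact: d0.
exact: clarkson_gt2.
Qed.

Lemma clarkson_of_disjoint D xi eta : (forall t, D t -> xi t = 0 \/ eta t = 0) ->
  (psum D (fun t => xi t + eta t)%R + psum D (fun t => xi t - eta t)%R =
    (psum D xi + psum D eta) + (psum D xi + psum D eta))%E.
Proof.
move=> h; rewrite esum_clark_sum esum_clark_dbl; apply: eq_esum => t /h {}h.
by rewrite clarkson_disjoint.
Qed.

End Psum.

(** * Ample groupoids and C_c *)

Section GroupoidLemmas.
Context {G : groupoidType}.
Implicit Types g h k t : G.

Lemma gmulKV g h : grng g = grng h -> gmul g (gmul (ginv g) h) = h.
Proof.
move=> e; rewrite gmulA ?gmulgV ?e ?gmul1g//; first by rewrite grng_inv.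
by rewrite gdom_inv.
Qed.

Lemma gmulVK g h : gdom g = gdom h -> gmul (gmul g (ginv h)) h = g.
Proof.
move=> e; rewrite -gmulA ?gdom_inv ?grng_inv//.
by rewrite gmulVg -e gmulg1.
Qed.

Lemma gmulK g h : gdom g = grng h -> gmul (gmul g h) (ginv h) = g.
Proof.
by move=> e; rewrite -gmulA ?grng_inv// gmulgV -e gmulg1.
Qed.

Lemma gmulKg g h : gdom g = grng h -> gmul (ginv g) (gmul g h) = h.
Proof.
by move=> e; rewrite gmulA ?gdom_inv// gmulVg e gmul1g.
Qed.

Lemma gmul_injl k g h : gdom k = grng g -> gdom k = grng h ->
  gmul k g = gmul k h -> g = h.
Proof. by move=> eg eh e; rewrite -(gmulKg eg) e gmulKg. Qed.

Lemma ginvK : involutive (@ginv G).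
Proof.
move=> g; apply: (@gmul_injl (ginv g)); rewrite ?grng_inv ?gdom_inv//.
by rewrite gmulgV grng_inv gmulVg.
Qed.

Lemma grng_div g k : gdom g = gdom k -> grng (gmul g (ginv k)) = grng g.
Proof. by move=> e; rewrite grng_mul// grng_inv. Qed.

Lemma gdom_div g k : gdom g = gdom k -> gdom (gmul g (ginv k)) = grng k.
Proof. by move=> e; rewrite gdom_mul ?gdom_inv// grng_inv. Qed.

Lemma grng_ldiv t g : grng t = grng g -> grng (gmul (ginv t) g) = gdom t.
Proof. by move=> e; rewrite grng_mul ?grng_inv// gdom_inv. Qed.

Lemma gdom_ldiv t g : grng t = grng g -> gdom (gmul (ginv t) g) = gdom g.
Proof. by move=> e; rewrite gdom_mul// gdom_inv. Qed.

Lemma gunitP g : @gunits G g -> set_val (gdom g) = g.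
Proof. by move=> /mem_set Gg; have := gdom_unit (SigSub Gg) => /= ->. Qed.

Lemma gunit_rng_dom g : @gunits G g -> grng g = gdom g.
Proof. by move=> /gunitP <-; rewrite grng_unit gdom_unit. Qed.

Lemma gunits_val (x : unit_space G) : @gunits G (set_val x).
Proof. exact: set_valP. Qed.

Lemma unit_val_inj (x y : unit_space G) : set_val x = set_val y :> G -> x = y.
Proof. by move=> e; rewrite -(gdom_unit x) e gdom_unit. Qed.

End GroupoidLemmas.

(** * Compact open bisections *)

Section AmpleTopology.
Context {G : topGroupoidType}.

Definition ample_weyl := [/\ ample G, weyl G & compact [set: unit_space G]].

Definition compact_bisection (W : set G) :=
  [/\ compact W, open W, set_inj W (@gdom G) & set_inj W (@grng G)].

Lemma local_homeo_cont (X Y : topologicalType) (f : X -> Y) :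
  local_homeomorphism f -> continuous f.
Proof.
move=> h x; have [U [oU Ux _ [cU _]]] := h x.
by move: cU; rewrite continuous_open_subspace// => /(_ x); apply; rewrite inE.
Qed.

Lemma local_homeo_open (X Y : topologicalType) (f : X -> Y) (O : set X) :
  local_homeomorphism f -> open O -> open (f @` O).
Proof.
move=> h oO; rewrite openE => _ [x Ox <-].
have [U [oU Ux ofU [cU [g [cg fU gU fg gf]]]]] := h x.
have ofx : (f @` U) (f x) by exists x.
have : nbhs (g (f x)) O by rewrite fg ?inE//; exact: open_nbhs_nbhs.
move: cg; rewrite continuous_open_subspace// => /(_ (f x) (mem_set ofx)) H /H.
move=> /= HO; rewrite /interior; near=> y.
have fUy : (f @` U) y by near: y; exact: open_nbhs_nbhs.
exists (g y); last by rewrite gf ?inE.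
by near: y.
Unshelve. all: by end_near.
Qed.

Hypothesis nG : ample_weyl.

Let ampleG : ample G. Proof. by case: nG. Qed.
Let etaleG : etale G. Proof. by case: ampleG. Qed.

Lemma ample_weyl_hausdorff : hausdorff_space G. Proof. by case: nG => _ []. Qed.

Lemma ample_weyl_effective : effective G. Proof. by case: nG => _ []. Qed.

Lemma gdom_cont : continuous (@gdom G).
Proof. by apply: local_homeo_cont; case: etaleG. Qed.

Lemma grng_cont : continuous (@grng G).
Proof. by apply: local_homeo_cont; case: etaleG. Qed.

Lemma gdom_open (O : set G) : open O -> open (@gdom G @` O).
Proof. by apply: local_homeo_open; case: etaleG. Qed.

Lemma set_val_cont : continuous (set_val : unit_space G -> G).
Proof. exact: initial_continuous. Qed.

Lemma cob_closed W : compact_bisection W -> closed W.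
Proof. by move=> [cW _ _ _]; exact: compact_closed ample_weyl_hausdorff cW. Qed.

Lemma unit_closed (W : set (unit_space G)) : compact W -> closed W.
Proof. exact: compact_closed unit_space_hausdorff. Qed.

(** Effectiveness presents the unit space as an interior. *)
Lemma open_gunits : open (@gunits G).
Proof. by rewrite -ample_weyl_effective; exact: open_interior. Qed.

Lemma compact_gunits : compact (@gunits G).
Proof.
have -> : @gunits G = set_val @` [set: unit_space G].
  apply/seteqP; split=> [g /gunitP <-|_ [x _ <-]]; first by exists (gdom g).
  exact: set_valP.
apply: continuous_compact; last by case: nG.
by apply: continuous_subspaceT => x; exact: set_val_cont.
Qed.

Lemma cob_gunits : compact_bisection (@gunits G).
Proof.
split; [exact: compact_gunits|exact: open_gunits| |];
  move=> g h; rewrite !inE => /gunitP + /gunitP.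
  by move=> <- <-; rewrite !gdom_unit => ->.
by move=> <- <-; rewrite !grng_unit => ->.
Qed.

Lemma cob_nbhs (O : set G) g : open O -> O g -> exists W, [/\ compact_bisection W, W g & W `<=` O].
Proof.
move=> oO Og; have [[hd hr] [B [Bo Bb] Bc]] := ampleG.
have [U [oU Ug _ [_ [u [_ _ _ uK _]]]]] := hd g.
have [V [oV Vg _ [_ [v [_ _ _ vK _]]]]] := hr g.
have : nbhs g (O `&` (U `&` V)).
  by apply: open_nbhs_nbhs; split; [do 2 apply: openI => //|].
move=> /(Bb g) [W [BW Wg] WO]; exists W; split => //.
- split; [exact: Bc|exact: Bo| |] => a b; rewrite !inE => Wa Wb e.
    by rewrite -(uK a) ?e ?uK// inE; [have [_ []] := WO _ Wb|have [_ []] := WO _ Wa].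
  by rewrite -(vK a) ?e ?vK// inE; [have [_ []] := WO _ Wb|have [_ []] := WO _ Wa].
- by move=> a /WO [].
Qed.

Lemma compact_cob_cover (K : set G) : compact K ->
  exists s : seq (set G), (forall W, W \in s -> compact_bisection W) /\
    (forall g, K g -> exists2 W, W \in s & W g).
Proof.
move=> cK; have [[k _]|K0] := pselect (K !=set0); last first.
  by exists [::]; split=> // g Kg; case: K0; exists g.
(* The covering form of compactness is stated for pointed spaces; the point [k] of [K] supplies the
   base point. *)
pose pG : ptopologicalType := HB.pack (G : Type) (isPointed.Build G k) G.
have h (g : G) : exists W, compact_bisection W /\ W g.
  by have [W [? ? _]] := @cob_nbhs setT g openT I; exists W.
pose F g := projT1 (cid (h g)).
have FP g : compact_bisection (F g) /\ F g g by exact: projT2 (cid (h g)).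
move: cK; rewrite (_ : compact K = @cover_compact pG K); last by rewrite -compact_cover.
move=> /(_ G K F)[g _|g Kg|D DK Dc].
- by have [[]] := FP g.
- by exists g => //; have [] := FP g.
exists [seq F g | g <- finmap.enum_fset D]; split=> [W /mapP[g _ ->]|g /Dc [i /= iD Fig]].
  by have [] := FP g.
by exists (F i) => //; apply: map_f.
Qed.

Lemma gdiv_cvg (O : set G) g k : gdom g = gdom k -> nbhs (gmul g (ginv k)) O ->
  exists A N, [/\ nbhs g A, nbhs k N &
    forall g' k', A g' -> N k' -> gdom g' = gdom k' -> O (gmul g' (ginv k'))].
Proof.
move=> e; have := @gmul_continuous G => /subspace_continuousP /(_ (g, ginv k)).
rewrite /= grng_inv => /(_ e) H /H; rewrite nbhs_simpl/= => -[[A N] [/= nA nN] AN].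
exists A, (@ginv G @^-1` N); split => //; first exact: (@ginv_continuous G k).
move=> g' k' Ag' Nk' e'.
by apply: (AN (g', ginv k')); rewrite /= ?grng_inv.
Qed.

End AmpleTopology.

Lemma closed_coincidence (X Y : topologicalType) (f g : X -> Y) :
  hausdorff_space Y -> continuous f -> continuous g -> closed [set x | f x = g x].
Proof.
rewrite open_hausdorff => hY cf cg; rewrite -openC openE => x /= /eqP fgx.
have [[A B] [/= /set_mem Af /set_mem Bg] [/= oA oB /eqP AB]] := hY _ _ fgx.
have nA : nbhs x (f @^-1` A) by apply: cf; exact: open_nbhs_nbhs.
have nB : nbhs x (g @^-1` B) by apply: cg; exact: open_nbhs_nbhs.
rewrite /interior; apply: filterS (filterI nA nB) => y [/= Ay By] e.
by have : set0 (f y) by rewrite -AB; split => //; rewrite e.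
Qed.

(** * Convolution on C_c *)

Section Cc.
Context {R : realType} {G : topGroupoidType}.
Hypothesis nG : @ample_weyl G.
Implicit Types (f h : G -> R[i]) (W K : set G).

Lemma Cc_of_supp f K : continuous (f : G -> R[i]^o) -> compact K ->
  (forall g, f g != 0 -> K g) -> Cc f.
Proof.
move=> cf cK fK; split => //.
apply: subclosed_compact (@closed_closure _ _) (cK) _.
have /closure_id -> := compact_closed (ample_weyl_hausdorff nG) cK.
exact: closure_subset.
Qed.

Lemma Cc_supp f : Cc f -> exists2 K, compact K & forall g, f g != 0 -> K g.
Proof.
move=> [_ cf]; exists (closure [set g | f g != 0]) => // g fg.
exact: subset_closure.
Qed.

Lemma Cc_lin (a : R[i]) f h : Cc f -> Cc h -> Cc (fun g => a * f g + h g).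
Proof.
move=> Cf Ch; have [[cf _] [ch _]] := (Cf, Ch).
have [K cK fK] := Cc_supp Cf; have [L cL hL] := Cc_supp Ch.
apply: (@Cc_of_supp _ (K `|` L)).
- move=> g; apply: (@cvgD _ (R[i]^o)); last exact: ch.
  by apply: (@cvgM (R[i])); [exact: cvg_cst|exact: cf].
- exact: compactU.
- move=> g; have [f0|/fK] := eqVneq (f g) 0; last by left.
  by rewrite f0 mulr0 add0r => /hL; right.
Qed.

Lemma Cc0 : Cc (fun _ : G => 0 : R[i]).
Proof.
apply: (@Cc_of_supp _ set0); first by move=> g; exact: cvg_cst.
- exact: compact0.
- by move=> g; rewrite eqxx.
Qed.

Lemma CcD f h : Cc f -> Cc h -> Cc (fun g => f g + h g).
Proof.
by move=> Cf Ch; have := Cc_lin 1 Cf Ch; under eq_fun do rewrite mul1r.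
Qed.

Lemma CcZ a f : Cc f -> Cc (fun g => a * f g).
Proof.
by move=> Cf; have := Cc_lin a Cf Cc0; under eq_fun do rewrite addr0.
Qed.

Lemma continuous_indic (T : topologicalType) (W : set T) :
  open W -> closed W -> continuous (\1_W : T -> R[i]^o).
Proof.
move=> oW cW g; apply: (@near_cst_continuous _ _ (\1_W g : R[i]^o)).
rewrite !indicE; have [Wg|nWg] := pselect (W g).
  have : nbhs g W by exact: open_nbhs_nbhs.
  by apply: filterS => t Wt; rewrite !indicE !mem_set.
have : nbhs g (~` W) by apply: open_nbhs_nbhs; split => //; exact: closed_openC.
by apply: filterS => t Wt; rewrite !indicE !memNset.
Qed.

Lemma Cc_indic W : open W -> compact W -> Cc (\1_W : G -> R[i]).
Proof.
move=> oW cW; apply: (@Cc_of_supp _ W) => //.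
  exact: continuous_indic (compact_closed (ample_weyl_hausdorff nG) cW).
by move=> g; rewrite indicE; case: (boolP (g \in W)) => [/[!inE]//|]; rewrite eqxx.
Qed.

Lemma Cc_cob W : compact_bisection W -> Cc (\1_W : G -> R[i]).
Proof. by move=> [cW oW _ _]; exact: Cc_indic. Qed.

Lemma CcM f W : Cc f -> compact_bisection W -> Cc (fun g => f g * \1_W g).
Proof.
move=> Cf cW; have [cf _] := Cf; have [K cK fK] := Cc_supp Cf.
apply: (@Cc_of_supp _ K); [|exact: cK|]; last first.
  by move=> g; rewrite mulf_eq0 negb_or => /andP[/fK].
move=> g; apply: (@cvgM (R[i])); first exact: cf.
by apply: continuous_indic; [case: cW|exact: cob_closed].
Qed.

(** Indicators of compact open bisections are continuous, so no partition of unity is required: from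
    a finite cover of the support the pieces h 1_W are split off one at a time, and the rest of the
    cover still contains the support of h - h 1_W. *)
Lemma Cc_ind (P : (G -> R[i]) -> Prop) : P (fun=> 0) ->
    (forall f h, P f -> P h -> P (fun g => f g + h g)) ->
    (forall W h, compact_bisection W -> Cc h -> (forall g, h g != 0 -> W g) -> P h) ->
  forall h, Cc h -> P h.
Proof.
move=> P0 PD PW h Ch; have [K cK hK] := Cc_supp Ch.
have [s [sC sK]] := compact_cob_cover nG cK.
have : forall g, h g != 0 -> exists2 W, W \in s & W g by move=> g /hK /sK.
elim: s {sK} sC h Ch {hK} => [|W s ih] sC h Ch hs.
  rewrite (_ : h = fun=> 0)//; apply/funext => g; apply/eqP/negPn/negP.
  by move=> /hs[].
have cW : compact_bisection W by apply: sC; rewrite inE eqxx.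
have -> : h = fun g => h g * \1_W g + (h g + (-1) * (h g * \1_W g)).
  by apply/funext => g; rewrite mulN1r addrC subrK.
apply: PD.
- apply: (PW W) => //; first exact: CcM.
  move=> g; rewrite indicE; have [/[!inE]//|] := boolP (g \in W).
  by rewrite mulr0 eqxx.
- apply: ih; first by move=> V Vs; apply: sC; rewrite inE Vs orbT.
  + by apply: CcD => //; apply: CcZ; exact: CcM.
  + move=> g; rewrite indicE; have [gW|gW] := boolP (g \in W).
      by rewrite mulr1 mulN1r subrr eqxx.
    rewrite !mulr0 addr0 => /hs[V]; rewrite inE => /orP[/eqP ->|Vs Vg]; last by exists V.
    by move=> Wg; move: gW; rewrite mem_set.
Qed.

(** Finitely many bisections cover the support, and each meets the fibre in at most one point. *)
Lemma finite_rfiber f (y : unit_space G) : Cc f ->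
  finite_set (rfiber y `&` [set t | f t != 0]).
Proof.
move=> Cf; have [K cK fK] := Cc_supp Cf.
have [s [sC sK]] := compact_cob_cover nG cK.
pose u W := xget (set_val y) (W `&` rfiber y).
apply: (@sub_finite_set _ _ [set` [seq u W | W <- s]]); last exact: finite_seq.
move=> t [/= rt /fK /sK [W Ws Wt]]; apply/mapP; exists W => //.
rewrite /u; case: xgetP => [t' -> [Wt' rt']|/(_ t)]; last by case.
by have [_ _ _ rW] := sC _ Ws; apply: rW; rewrite ?inE// rt rt'.
Qed.

Lemma convolE f h g : convol f h g =
  \sum_(t \in rfiber (grng g) `&` [set t | f t != 0]) f t * h (gmul (ginv t) g).
Proof.
rewrite /convol; apply/esym/fsbig_widen; first by move=> t [].
move=> t [rt /not_andP[//|/negP]]; rewrite negbK => /eqP f0.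
by rewrite /= f0 mul0r.
Qed.

Lemma convolDr f h1 h2 : Cc f ->
  convol f (fun g => h1 g + h2 g) = fun g => convol f h1 g + convol f h2 g.
Proof.
move=> Cf; apply/funext => g; rewrite !convolE.
rewrite -fsbig_split; last exact: finite_rfiber.
by apply: eq_fsbigr => t _; rewrite mulrDr.
Qed.

Lemma convolZr f a h : convol f (fun g => a * h g) = fun g => a * convol f h g.
Proof.
apply/funext => g; rewrite /convol mulr_fsumr.
by apply: eq_fsbigr => t _; rewrite mulrCA.
Qed.

Lemma eq_convol f h1 h2 g : (forall k, gdom k = gdom g -> h1 k = h2 k) ->
  convol f h1 g = convol f h2 g.
Proof.
move=> e; apply: eq_fsbigr => t; rewrite inE /rfiber/= => rt.
by rewrite e// gdom_ldiv.
Qed.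

(** A term survives only if t^-1 g lies in W; having the same domain as k, it must then be k, so t =
    g k^-1. *)
Lemma convol_supp1r f h W g k : set_inj W (@gdom G) ->
    (forall t, h t != 0 -> W t) -> W k -> gdom k = gdom g ->
  convol f h g = f (gmul g (ginv k)) * h k.
Proof.
move=> dW hW Wk e; rewrite /convol.
rewrite -(@fsbig_widen _ _ _ _ [set gmul g (ginv k)]).
- rewrite fsbig_set1; congr (_ * h _).
  have e' := esym e; apply: (@gmul_injl _ (gmul g (ginv k))).
  + by rewrite grng_ldiv ?grng_div.
  + by rewrite gdom_div.
  + by rewrite gmulKV ?grng_div// gmulVK.
- by move=> t ->; rewrite /rfiber/= grng_div.
- move=> t [rt tgk]; apply/eqP; rewrite mulf_eq0; apply/orP; right.
  apply/negPn/negP => /hW Wt; apply: tgk.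
  have tk : gmul (ginv t) g = k by apply: dW; rewrite ?inE// gdom_ldiv.
  by rewrite /= -(gmulKV rt) tk gmulK// -tk grng_ldiv.
Qed.

Lemma convol_supp0r f h W g : (forall t, h t != 0 -> W t) ->
  (forall k, W k -> gdom k != gdom g) -> convol f h g = 0.
Proof.
move=> hW Wg; rewrite /convol fsbig1// => t rt; apply/eqP.
rewrite mulf_eq0; apply/orP; right; apply/negPn/negP => /hW /Wg.
by rewrite gdom_ldiv// eqxx.
Qed.

Let gmulim K W := (fun gh : G * G => gmul gh.1 gh.2) @`
  ((K `*` W) `&` [set gh : G * G | gdom gh.1 = grng gh.2]).

(** Composable pairs form a closed set because the unit space is Hausdorff; multiplication is
    continuous on it. *)
Let compact_gmulim K W : compact K -> compact W -> compact (gmulim K W).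
Proof.
move=> cK cW; apply: continuous_compact.
  apply: continuous_subspaceW (@gmul_continuous G).
  by move=> gh [].
apply: compact_closedI; first exact: compact_setX.
apply: closed_coincidence (@unit_space_hausdorff G) _ _ => gh.
  by apply: (@continuous_comp _ _ _ fst); [exact: cvg_fst|exact: gdom_cont].
by apply: (@continuous_comp _ _ _ snd); [exact: cvg_snd|exact: grng_cont].
Qed.

Lemma Cc_convol f h : Cc f -> Cc h -> Cc (convol f h).
Proof.
move=> Cf; have [cf _] := Cf; have [K cK fK] := Cc_supp Cf.
move: h; apply: Cc_ind.
- rewrite (_ : convol _ _ = fun=> 0); first exact: Cc0.
  by apply/funext => g; rewrite /convol fsbig1// => t _; rewrite mulr0.
- by move=> h1 h2 C1 C2; rewrite convolDr; [exact: CcD C1 C2|exact: Cf].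
move=> W h cW [ch _] hW; have [kW oW dW rW] := cW.
apply: (@Cc_of_supp _ (gmulim K W)); last first.
- move=> g gN0; have [[k [Wk dk]]|/forallNP nk] := pselect (exists k, W k /\ gdom k = gdom g).
    move: gN0; rewrite (convol_supp1r _ dW hW Wk dk) mulf_eq0 negb_or => /andP[/fK Kg _].
    exists (gmul g (ginv k), k) => /=; first by rewrite gdom_div.
    by rewrite gmulVK.
  move: gN0; rewrite (convol_supp0r _ hW) ?eqxx// => k Wk.
  by apply/eqP => e; apply: (nk k).
- exact: compact_gmulim.
(* Continuity at [g0] splits according to whether d(g0) lies in d(W), a set that is open as [gdom]
   is open and closed as W is compact. *)
move=> g0; have [[k0 [Wk0 dk0]]|/forallNP nk] := pselect (exists k, W k /\ gdom k = gdom g0).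
- rewrite /continuous_at (convol_supp1r _ dW hW Wk0 dk0).
  set z := f _; move=> O.
  have cM : (fun xy : R[i]^o * R[i]^o => (xy.1 * xy.2 : R[i]^o)) @
       nbhs (z : R[i]^o, h k0 : R[i]^o) --> (z * h k0 : R[i]^o).
    by apply: (@cvgM (R[i])); [exact: cvg_fst|exact: cvg_snd].
  move=> /cM [[A B] /= [nA nB] ABO].
  have [A' [N [nA' nN AN]]] := gdiv_cvg (esym dk0) (cf _ _ nA).
  have nN' : nbhs k0 (N `&` (h @^-1` B) `&` W).
    by apply: filterI; [apply: filterI => //; exact: ch|exact: open_nbhs_nbhs].
  (* Openness of [gdom] provides, for every g near [g0], a point k of W near [k0] with d(k) = d(g);
     the one-term formula then varies continuously. *)
  have := gdom_open nG (@open_interior _ (N `&` (h @^-1` B) `&` W)).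
  set V := _ @` _ => oV; have Vg0 : V (gdom g0) by exists k0.
  have nV : nbhs g0 (@gdom G @^-1` V).
    by apply: (gdom_cont nG); exact: open_nbhs_nbhs.
  apply: filterS (filterI nA' nV) => g [A'g [k /interior_subset [[Nk Bk] Wk] dk]].
  rewrite /= (convol_supp1r _ dW hW Wk dk).
  by apply: (ABO (_, _)); split => //=; exact: AN.
- have cl : closed (@gdom G @` W).
    apply: unit_closed; apply: continuous_compact => //.
    by apply: continuous_subspaceT => x; exact: gdom_cont.
  have n0 : nbhs g0 (@gdom G @^-1` ~` (@gdom G @` W)).
    apply: (gdom_cont nG); apply: open_nbhs_nbhs; split; first exact: closed_openC.
    by move=> [k Wk dk]; apply: (nk k).
  apply: (@near_cst_continuous _ _ (0 : R[i]^o)); apply: filterS n0 => g ng.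
  rewrite (convol_supp0r _ hW)// => k Wk; apply/eqP => e.
  by apply: ng; exists k.
Qed.

End Cc.

(** * Matrix coefficients in the reduced algebra *)

Section ReducedNorm.
Context {R : realType} (p : R).
Hypothesis p1 : 1 <= p.
Context {G : topGroupoidType}.
Hypothesis nG : @ample_weyl G.
Context {A : banachAlgType R[i]} (iA : (G -> R[i]) -> A).
Hypothesis FA : is_Fp_lambda p iA.
Implicit Types (f h xi : G -> R[i]) (x : unit_space G) (c : R).

Let p_gt0 : 0 < p. Proof. by rewrite (lt_le_trans _ p1). Qed.
Let p_neq0 : p != 0. Proof. by rewrite gt_eqF. Qed.

Lemma psum_ge0 x xi : (0 <= psum p (dfiber x) xi)%E.
Proof. by apply: esum_ge0 => t _; rewrite lee_fin powR_ge0. Qed.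

Lemma lpnorm_leP x xi c : 0 <= c ->
  (lpnorm p x xi <= c%:E)%E <-> ple p (dfiber x) xi c.
Proof.
move=> c0; rewrite /ple.
have -> : lpnorm p x xi = poweR (psum p (dfiber x) xi) p^-1 by [].
have := psum_ge0 x xi; case: (psum _ _ _) => [s|_|//]; last first.
  by rewrite poweRyr ?invr_eq0//; split=> /=; rewrite leNgt ltry.
rewrite lee_fin => s0; rewrite poweR_EFin !lee_fin; split=> h.
  have := ge0_ler_powR (ltW p_gt0) _ _ h.
  by rewrite -powRrM mulVf// powRr1//; apply; rewrite nnegrE ?powR_ge0.
have pV0 : 0 <= p^-1 by rewrite invr_ge0 ltW.
have := ge0_ler_powR pV0 _ _ h.
by rewrite -powRrM divff// powRr1//; apply; rewrite nnegrE ?powR_ge0.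
Qed.

(** The reduced norm controls the action on unit vectors supported in the fibre; scaling by 1/c and
    cutting [xi] off outside the fibre reduces to these. For c = 0 the vector vanishes on the
    fibre. *)
Lemma ple_convol x f xi c : Cc f -> 0 <= c -> ple p (dfiber x) xi c ->
  ple p (dfiber x) (convol f xi) (nrm (iA f) * c).
Proof.
move=> Cf; rewrite le_eqVlt => /predU1P[<- h|c0 h].
  rewrite mulr0 /ple psum_eq0 ?lee_fin ?powR_ge0// => t tx.
  rewrite (@eq_convol _ _ f xi (fun=> 0)) => [|k kt].
    by rewrite /convol fsbig1// => k _; rewrite mulr0.
  by apply: (ple0 p1 h); rewrite /dfiber/= kt.
pose xi' := fun g => if gdom g == x then (c^-1)%:C%C * xi g else 0.
have hxi' : ple p (dfiber x) xi' 1.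
  have := @pleZ R _ p (dfiber x) xi c (c^-1)%:C%C (ltW c0) h.
  rewrite nrmc ger0_norm ?invr_ge0 ?ltW// mulVf ?gt_eqF//.
  by apply: ple_eq => t tx; rewrite /xi' tx eqxx.
have lx : (lpnorm p x xi' <= 1%:E)%E by apply/lpnorm_leP.
have sx : lp_space p x xi'.
  split; last by rewrite (le_lt_trans lx)// ltry.
  by move=> g gx; rewrite /xi'; case: eqP.
have h1 : (lpnorm p x (convol f xi') <= (nrm (iA f))%:E)%E.
  rewrite [X in (_ <= X)%E](Fp_isometric FA Cf) /reduced_norm le_max; apply/orP; right.
  apply: (@le_trans _ _ (lp_opnorm p x (lambda x f))).
    by apply: ereal_sup_ubound; exists xi'.
  by apply: ereal_sup_ubound; exists x.
move/(lpnorm_leP _ _ (nrm_ge0 _)) in h1.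
have := @pleZ R _ p _ _ _ (c%:C%C) (nrm_ge0 _) h1.
rewrite nrmc ger0_norm ?ltW// mulrC; apply: ple_eq => t tx.
rewrite -[LHS]/((fun g => c%:C%C * convol f xi' g) t) -convolZr.
apply: eq_convol => k kt; rewrite /xi' kt tx eqxx mulrA -rmorphM/= divff ?gt_eqF//.
by rewrite mul1r.
Qed.

Lemma convolr1 f : convol f \1_(@gunits G) = f.
Proof.
apply/funext => g.
have [_ _ dU _] := cob_gunits nG.
rewrite (@convol_supp1r _ _ f _ _ g (set_val (gdom g)) dU) ?gdom_unit//.
- rewrite indicE mem_set ?mulr1; last exact: gunits_val.
  by rewrite -{1}(gmulg1 g) gmulK// grng_unit.
- by move=> t; rewrite indicE; case: (boolP (t \in _)) => [/[!inE]//|]; rewrite eqxx.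
- exact: gunits_val.
Qed.

(** On the fibre over x the indicator of the units is the point mass at x, of norm 1, and f is its
    image under convolution by f. *)
Lemma ple_Cc x f : Cc f -> ple p (dfiber x) f (nrm (iA f)).
Proof.
move=> Cf; rewrite -[f in ple _ _ f _](convolr1 f) -[nrm _]mulr1.
apply: ple_convol => //; apply: (ple_set1 p1 (x := set_val x)) => // [t tx tnx|_].
  rewrite indicE memNset// => /gunitP; rewrite tx => e.
  by move: tnx; rewrite e eqxx.
by rewrite indicE; case: (_ \in _); rewrite ?nrm1 ?nrm0.
Qed.

Lemma nrm_Cc_le f g : Cc f -> nrm (f g) <= nrm (iA f).
Proof. by move=> Cf; apply: (ple_nrm_le p1 (ple_Cc (gdom g) Cf)) => //; exact: nrm_ge0. Qed.

Lemma iA_B f h : Cc f -> Cc h -> iA (fun g => f g - h g) = iA f - iA h.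
Proof.
move=> Cf Ch; have := Fp_linear FA (-1) Ch Cf; rewrite scaleN1r addrC => <-.
by congr iA; apply/funext => g; rewrite mulN1r addrC.
Qed.

Lemma CcB f h : Cc f -> Cc h -> Cc (fun g => f g - h g).
Proof.
move=> Cf Ch; have := Cc_lin nG (-1) Ch Cf.
by under eq_fun do rewrite mulN1r addrC.
Qed.

Lemma iA_inj f h : Cc f -> Cc h -> iA f = iA h -> f = h.
Proof.
move=> Cf Ch e; apply/funext => g; apply: subr0_eq; apply: nrm0_eq0.
apply/eqP; rewrite eq_le nrm_ge0 andbT.
by have := nrm_Cc_le g (CcB Cf Ch); rewrite iA_B// e subrr nrm0.
Qed.

Lemma Cc_dense (b : A) e : 0 < e -> exists2 f, Cc f & nrm (b - iA f) < e.
Proof.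
move=> e0; have : closure (iA @` Cc) b by rewrite (Fp_dense FA).
have e0' : 0 < e%:C%C :> R[i] by rewrite ltcR.
move=> /(_ _ (nbhsx_ballx b _ e0')) [_ [[f Cf <-]]].
by rewrite -ball_normE/= nrmE ltcR => h; exists f.
Qed.

End ReducedNorm.

Section BanachMul.
Context {R : realType} {A : banachAlgType R[i]}.
Implicit Types a b c : A.

Lemma nrm_bmul a b : nrm (bmul a b) <= nrm a * nrm b.
Proof. by rewrite -lecR rmorphM/= -!nrmE ler_normbM. Qed.

Lemma bmulNl a b : bmul (- a) b = - bmul a b.
Proof. by rewrite -(scaleN1r a) -bscaleAl scaleN1r. Qed.

Lemma bmulNr a b : bmul a (- b) = - bmul a b.
Proof. by rewrite -(scaleN1r b) -bscaleAr scaleN1r. Qed.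

Lemma bmulBl a b c : bmul (a - b) c = bmul a c - bmul b c.
Proof. by rewrite bmulDl bmulNl. Qed.

Lemma bmulBr a b c : bmul a (b - c) = bmul a b - bmul a c.
Proof. by rewrite bmulDr bmulNr. Qed.

Lemma bmulr0 a : bmul a 0 = 0.
Proof. by apply: (addrI (bmul a 0)); rewrite -bmulDr !addr0. Qed.

End BanachMul.

(** * Extension of coefficients to the completion *)

Section Coefficients.
Context {R : realType} (p : R).
Hypothesis p1 : 1 <= p.
Context {G : topGroupoidType}.
Hypothesis nG : @ample_weyl G.
Context {A : banachAlgType R[i]} (iA : (G -> R[i]) -> A).
Hypothesis FA : is_Fp_lambda p iA.
Implicit Types (f h xi : G -> R[i]) (x : unit_space G) (a b c d : A).

(* The injective map from F^p_lambda(G) to functions on G that extends the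
   identity of C_c(G): [coef b g] is the matrix coefficient of [b] at
   (g, d(g)). The factor 2 pays for extending real and imaginary parts
   separately. *)
Definition coef b g : R[i] :=
  xget 0 [set z | forall f, Cc f -> nrm (z - f g) <= 2 * nrm (b - iA f)].

(** McShane extension of a 1-Lipschitz real function from C_c to the point [b]: the value is the
    supremum of F f - |b - f|. *)
Let extend_real (F : (G -> R[i]) -> R) b :
    (forall f h, Cc f -> Cc h -> F f - F h <= nrm (iA f - iA h)) ->
  exists z, forall f, Cc f -> `|z - F f| <= nrm (b - iA f).
Proof.
move=> hF; pose E := [set F f - nrm (b - iA f) | f in @Cc R G].
have ub f : Cc f -> ubound E (F f + nrm (b - iA f)).
  move=> Cf _ [h Ch <-]; have h1 := hF _ _ Ch Cf.
  have := ler_nrm_distD b (iA h) (iA f); rewrite (nrmBC (iA h) b); lra.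
exists (sup E) => f Cf; rewrite ler_norml; apply/andP; split.
  rewrite lerBrDr addrC; apply: ub_le_sup; last by exists f.
  by exists (F f + nrm (b - iA f)); exact: ub.
rewrite lerBlDr addrC; apply: ge_sup; last exact: ub.
by exists (F f - nrm (b - iA f)); exists f.
Qed.

Lemma coefP b f g : Cc f -> nrm (coef b g - f g) <= 2 * nrm (b - iA f).
Proof.
rewrite /coef; case: xgetP => [z -> hz|H _]; first exact: hz.
have hN f1 h1 : Cc f1 -> Cc h1 -> nrm (f1 g - h1 g) <= nrm (iA f1 - iA h1).
  move=> C1 C2; rewrite -(iA_B FA)//.
  exact: (nrm_Cc_le p1 nG FA g (CcB nG C1 C2)).
have [u hu] : exists z, forall f, Cc f -> `|z - complex.Re (f g)| <= nrm (b - iA f).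
  apply: extend_real => f1 h1 C1 C2; apply: le_trans (hN _ _ C1 C2).
  by rewrite -raddfB (le_trans (ler_norm _))// Re_nrm.
have [v hv] : exists z, forall f, Cc f -> `|z - complex.Im (f g)| <= nrm (b - iA f).
  apply: extend_real => f1 h1 C1 C2; apply: le_trans (hN _ _ C1 C2).
  by rewrite -raddfB (le_trans (ler_norm _))// Im_nrm.
(* The extended real and imaginary parts form an admissible value, so [xget] never falls back on its
   default 0. *)
have := H (u +i* v)%C; case=> f1 C1.
rewrite (le_trans (nrm_Re_Im _))//= mulr2n mulrDl mul1r.
by rewrite lerD// !raddfB/= ?hu ?hv.
Qed.

Lemma coef_iA f : Cc f -> coef (iA f) = f.
Proof.
move=> Cf; apply/funext => g; apply: subr0_eq; apply: nrm0_eq0; apply/eqP.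
by rewrite eq_le nrm_ge0 andbT (le_trans (coefP _ _ Cf))// subrr nrm0 mulr0.
Qed.

Lemma coef_lin k b c g : coef (k *: b + c) g = k * coef b g + coef c g.
Proof.
apply: (@eq_nrm_le _ _ (4 * (nrm k + 1))) => e e0.
have [f Cf hf] := Cc_dense FA b e0; have [h Ch hh] := Cc_dense FA c e0.
have := coefP (k *: b + c) g (Cc_lin nG k Cf Ch); rewrite (Fp_linear FA)// => h1.
have h2 := coefP b g Cf; have h3 := coefP c g Ch.
have k0 := nrm_ge0 k.
rewrite (le_trans (ler_nrm_distD (k * f g + h g) _ _))//.
have h4 : nrm (k *: b + c - (k *: iA f + iA h)) <= nrm k * e + e.
  rewrite opprD addrACA -scalerBr (le_trans (ler_nrmD _ _))// nrmZ.
  by apply: lerD; [rewrite ler_wpM2l// ltW|exact: ltW].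
have h5 : nrm (k * f g + h g - (k * coef b g + coef c g)) <= nrm k * (2 * e) + 2 * e.
  rewrite opprD addrACA -mulrBr (le_trans (ler_nrmD _ _))// nrmM lerD//.
    by rewrite ler_wpM2l// nrmBC (le_trans h2)// ler_pM2l// ltW.
  by rewrite nrmBC (le_trans h3)// ler_pM2l// ltW.
lra.
Qed.

Lemma coefD b c g : coef (b + c) g = coef b g + coef c g.
Proof. by rewrite -[b]scale1r coef_lin mul1r scale1r. Qed.

Lemma coef0 g : coef 0 g = 0.
Proof. by apply: (addrI (coef 0 g)); rewrite -coefD !addr0. Qed.

Lemma coefZ k b g : coef (k *: b) g = k * coef b g.
Proof. by rewrite -[k *: b]addr0 coef_lin coef0 addr0. Qed.

Lemma coefN b g : coef (- b) g = - coef b g.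
Proof. by rewrite -scaleN1r coefZ mulN1r. Qed.

Lemma coefB b c g : coef (b - c) g = coef b g - coef c g.
Proof. by rewrite coefD coefN. Qed.

(** [coef b] is a uniform limit of continuous functions. With n the modulus at g and approximation
    within n/6, the errors at g, at t and in between are n/3, n/3 and n/6, which together stay below
    n. *)
Lemma open_coef_neq0 b : open [set g | coef b g != 0].
Proof.
rewrite openE => g /= bg; have e0 : 0 < nrm (coef b g) / 6 by rewrite divr_gt0// nrm_gt0.
have [f Cf hf] := Cc_dense FA b e0.
have [cf _] := Cf.
have e0' : 0 < (nrm (coef b g) / 6)%:C%C :> R[i] by rewrite ltcR.
have /(@cvgrPdist_lt _ (R[i]^o)) /(_ _ e0') nf := cf g.
rewrite /interior; apply: filterS nf => t /=; rewrite nrmE ltcR => ft.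
have h1 := coefP b g Cf; have h2 := coefP b t Cf.
apply/negP => /eqP bt0.
have h3 := ler_nrm_distD (f g) (coef b g) 0.
have h4 := ler_nrm_distD (f t) (f g) 0.
move: h2; rewrite bt0 sub0r nrmN; move: h3 h4; rewrite !subr0; lra.
Qed.

Lemma ple_coef x b : ple p (dfiber x) (coef b) (nrm b).
Proof.
apply: (@ple_closed R _ p p1 _ _ _ 2) => //; first exact: nrm_ge0.
move=> e e0; have [f Cf hf] := Cc_dense FA b e0; exists f.
  by move=> t _; rewrite (le_trans (coefP _ _ Cf))// ler_pM2l// ltW.
apply: (ple_le p1 (nrm_ge0 _) _ (ple_Cc p1 nG FA x Cf)).
have := ler_nrm_distD b (iA f) 0; rewrite !subr0 nrmBC; lra.
Qed.

(** The bound [m] concerns the column of [c] at x alone and may be far below the norm of [c]; thus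
    [b] acts on columns as an operator of norm at most [nrm b]. *)
Lemma ple_coef_bmul x b c m : 0 <= m -> ple p (dfiber x) (coef c) m ->
  ple p (dfiber x) (coef (bmul b c)) (nrm b * m).
Proof.
move=> m0 cm; have b0 := nrm_ge0 b; have c0 := nrm_ge0 c.
apply: (@ple_closed R _ p p1 _ _ _ (2 * (nrm c + nrm b + 1) + m)).
- exact: mulr_ge0.
- by rewrite addr_ge0// mulr_ge0// !addr_ge0.
(* Taking [d] at most 1 bounds the quadratic error d^2 by d. *)
move=> e e0; pose d := Num.min e 1.
have d0 : 0 < d by rewrite lt_min e0/=.
have de : d <= e by rewrite ge_min lexx.
have d1 : d <= 1 by rewrite ge_min lexx orbT.
have [f Cf hf] := Cc_dense FA b d0; have [h Ch hh] := Cc_dense FA c d0.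
have fb : nrm (iA f) <= nrm b + d.
  by have := ler_nrm_distD b (iA f) 0; rewrite !subr0 nrmBC; lra.
have f0 := nrm_ge0 (iA f); have h0 := nrm_ge0 (c - iA h).
have hb0 := nrm_ge0 (b - iA f).
exists (convol f h).
  move=> t _; rewrite (le_trans (coefP _ _ (Cc_convol nG Cf Ch)))//.
  rewrite (Fp_mul FA)//.
  have -> : bmul b c - bmul (iA f) (iA h) =
      bmul (b - iA f) c + bmul (iA f) (c - iA h).
    by rewrite bmulBl bmulBr addrA subrK.
  have h1 := le_trans (ler_nrmD _ _)
    (lerD (nrm_bmul (b - iA f) c) (nrm_bmul (iA f) (c - iA h))).
  nra.
have hm : ple p (dfiber x) h (m + d).
  have hx : ple p (dfiber x) (coef (iA h - c)) d.
    by apply: (ple_le p1 (nrm_ge0 _) _ (ple_coef x _)); rewrite nrmBC ltW.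
  have := pleD p1 m0 (ltW d0) cm hx; apply: ple_eq => t _.
  by rewrite coefB coef_iA// addrCA subrr addr0.
have md0 : 0 <= m + d by rewrite addr_ge0// ltW.
apply: (ple_le p1 _ _ (ple_convol p1 FA Cf md0 hm)); first exact: mulr_ge0.
nra.
Qed.

(** The column of [b - c] at x has norm 0, hence so does its image under [a]: left multiplication is
    well defined on columns. *)
Lemma coef_bmul_fiber x a b c : (forall g, gdom g = x -> coef b g = coef c g) ->
  forall g, gdom g = x -> coef (bmul a b) g = coef (bmul a c) g.
Proof.
move=> h g gx; apply: subr0_eq; rewrite -coefB -bmulBr.
suff h0 : ple p (dfiber x) (coef (bmul a (b - c))) 0 by exact: (ple0 p1 h0 (gx : dfiber x g)).
rewrite -(mulr0 (nrm a)); apply: ple_coef_bmul => //.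
rewrite /ple psum_eq0 ?lee_fin ?powR_ge0// => t tx.
by rewrite coefB (h _ tx) subrr.
Qed.

Lemma coef_bmul_indic c W k g : compact_bisection W -> W k -> gdom k = gdom g ->
  coef (bmul c (iA \1_W)) g = coef c (gmul g (ginv k)).
Proof.
move=> cW Wk dk; have CW := Cc_cob nG cW (R := R); have [_ _ dW _] := cW.
apply: (@eq_nrm_le _ _ (2 * nrm (iA \1_W) + 2)) => e e0.
have [f Cf hf] := Cc_dense FA c e0.
have h1 := coefP (bmul c (iA \1_W)) g (Cc_convol nG Cf CW).
rewrite (Fp_mul FA)// -bmulBl in h1.
have h2 := coefP c (gmul g (ginv k)) Cf.
have h3 := nrm_bmul (c - iA f) (iA \1_W).
have W0 := nrm_ge0 (iA \1_W).
have e1 : convol f \1_W g = f (gmul g (ginv k)).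
  rewrite (@convol_supp1r _ _ f _ _ g k dW)// ?indicE ?mem_set ?mulr1//.
  by move=> t; rewrite indicE; case: (boolP (t \in _)) => [/[!inE]//|]; rewrite eqxx.
rewrite e1 in h1.
rewrite (le_trans (ler_nrm_distD (f (gmul g (ginv k))) _ _))//.
rewrite [X in _ + X]nrmBC; nra.
Qed.

(** Only the column over d(k) matters, and there [b] agrees with a multiple of 1_W for any compact
    bisection W through k; right multiplication by 1_W is a translation. *)
Lemma coef_bmul_col c b k g : gdom g = gdom k ->
    (forall t, gdom t = gdom k -> t != k -> coef b t = 0) ->
  coef (bmul c b) g = coef c (gmul g (ginv k)) * coef b k.
Proof.
move=> dg hb; have [W [cW Wk _]] := cob_nbhs nG openT (I : [set: G] k).
have [_ _ dW _] := cW.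
rewrite (@coef_bmul_fiber (gdom k) c b (coef b k *: iA \1_W))//.
  by rewrite -bscaleAr coefZ (coef_bmul_indic _ cW Wk)// mulrC.
move=> t dt; rewrite coefZ coef_iA; last exact: Cc_cob.
rewrite indicE; have [->|tk] := eqVneq t k; first by rewrite mem_set// mulr1.
rewrite memNset ?mulr0 ?hb// => Wt.
by move: tk; rewrite (dW t k) ?eqxx ?inE.
Qed.

(** Finitely supported vectors on a fibre extend to C_c as sums of multiples of indicators of
    bisections, each meeting the fibre at one point. The last clause holds because d 1_W has
    translates of the coefficients of d as its own. *)
Let finite_section x xi (r : seq G) : uniq r -> (forall t, t \in r -> dfiber x t) ->
  exists h, [/\ Cc h, forall t, t \in r -> h t = xi t,
     forall t, dfiber x t -> t \notin r -> h t = 0 &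
     forall d, coef d = (fun=> 0) -> forall g, dfiber x g -> coef (bmul d (iA h)) g = 0].
Proof.
elim: r => [|k r ih] /=.
  move=> _ _; exists (fun=> 0); split => //; first exact: Cc0.
  move=> d _ g _; rewrite (_ : iA (fun=> 0) = 0).
    by rewrite bmulr0 coef0.
  by have := iA_B FA (Cc0 nG) (Cc0 nG); rewrite subrr subrr.
move=> /andP[kr ur] rx; have [|h [Ch hr h0 hd]] := ih ur.
  by move=> t tr; apply: rx; rewrite inE tr orbT.
have kx : dfiber x k by apply: rx; rewrite inE eqxx.
have [W [cW Wk _]] := cob_nbhs nG openT (I : [set: G] k).
have CW := Cc_cob nG cW (R := R); have [_ _ dW _] := cW.
have W0 t : dfiber x t -> t != k -> t \notin W.
  move=> tx /eqP tk; apply/negP => tW; apply: tk; apply: (dW t k tW (mem_set Wk)).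
  by rewrite (tx : gdom t = x) (kx : gdom k = x).
exists (fun t => xi k * \1_W t + h t); split.
- exact: Cc_lin.
- move=> t; rewrite inE => /orP[/eqP ->|tr].
    by rewrite indicE mem_set// mulr1 h0// addr0.
  rewrite indicE (negbTE (W0 _ _ _)) ?mulr0 ?add0r ?hr//.
    by apply: rx; rewrite inE tr orbT.
  by apply: contraNneq kr => <-.
- move=> t tx; rewrite inE negb_or => /andP[tk tr].
  by rewrite indicE (negbTE (W0 _ _ _))// mulr0 add0r h0.
- move=> d d0 g gx; rewrite (Fp_linear FA)// bmulDr -bscaleAr coef_lin hd// addr0.
  rewrite (coef_bmul_indic _ cW Wk) ?d0 ?mulr0//.
  by rewrite (gx : gdom g = x) (kx : gdom k = x).
Qed.

(** If d has zero coefficients and f is close to d, then on the fibre f * h = (f - d) h for finite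
    sections h, so f has small norm on finitely supported vectors; these suffice to compute the
    reduced norm of f. *)
Lemma coef_inj b c : coef b = coef c -> b = c.
Proof.
move=> bc; pose d := b - c.
have d0 : coef d = fun=> 0 by apply/funext => g; rewrite coefB bc subrr.
apply: (@eq_nrm_le _ _ 2) => e e0; rewrite -/d.
have [f Cf hf] := Cc_dense FA d e0.
suff : nrm (iA f) <= e.
  by have := ler_nrm_distD (iA f) d 0; rewrite !subr0; lra.
rewrite -lee_fin [X in (X <= _)%E](Fp_isometric FA Cf) /reduced_norm ge_max.
rewrite lee_fin ltW//=; apply: ge_ereal_sup => _ [x _ <-].
apply: ge_ereal_sup => _ [xi [_ /= xi1] <-].
apply/(lpnorm_leP p1); first exact: ltW.
move/(lpnorm_leP p1 _ _ ler01) : xi1 => xi1.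
apply/pleP => r ur rx.
pose S t : seq G :=
  finmap.enum_fset (fset_set (rfiber (grng t) `&` [set u | f u != 0])).
have SE t u : (u \in S t) = (u \in rfiber (grng t) `&` [set u | f u != 0]).
  exact: in_fset_set (finite_rfiber nG (grng t) Cf) u.
(* [X] collects the points at which [xi] is evaluated when computing f * xi on [r], so a finite
   section that agrees with [xi] on [X] gives the same values there. *)
pose X := undup [seq gmul (ginv u) t | t <- r, u <- S t].
have Xx t : t \in X -> dfiber x t.
  rewrite mem_undup => /allpairsPdep[t' [u [tr uS ->]]].
  move: uS; rewrite SE inE => -[ru _].
  by rewrite /dfiber/= gdom_ldiv// (rx t' tr : gdom t' = x).
have [h [Ch hX h0 hd]] := finite_section xi (undup_uniq _) Xx.
have h1 : ple p (dfiber x) h 1.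
  apply: le_trans xi1; apply: le_esum => t tx; rewrite lee_fin.
  have [/hX ->//|tX] := boolP (t \in X).
  by rewrite h0// nrm0 powR0 ?powR_ge0// gt_eqF// (lt_le_trans _ p1).
have fh : ple p (dfiber x) (convol f h) e.
  have hl : ple p (dfiber x) (coef (iA h)) 1 by rewrite coef_iA.
  have := ple_coef_bmul (iA f - d) ler01 hl; rewrite mulr1 nrmBC => H.
  apply: (ple_le p1 (nrm_ge0 _) (ltW hf)); move: H; apply: ple_eq => t tx.
  rewrite bmulBl coefB (hd _ d0 _ tx) subr0 -(Fp_mul FA)// coef_iA//.
  exact: Cc_convol.
have := (pleP p _ _ _).1 fh r ur rx.
congr (_ <= _); rewrite big_seq [RHS]big_seq; apply: eq_bigr => t tr.
congr (nrm _ `^ p); rewrite /lambda !convolE; apply: eq_fsbigr => u; rewrite inE => uS.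
rewrite hX// mem_undup; apply/allpairsPdep; exists t, u; split => //.
by rewrite SE inE.
Qed.

Lemma convol1l f : convol \1_(@gunits G) f = f.
Proof.
apply/funext => g; rewrite /convol.
rewrite -(@fsbig_widen _ _ _ _ [set set_val (grng g) : G]).
- rewrite fsbig_set1 indicE mem_set ?mul1r; last exact: gunits_val.
  by rewrite -[g in gmul _ g]gmul1g gmulKg// gdom_unit.
- by move=> _ ->; rewrite /rfiber/= grng_unit.
- move=> t [rt tg] /=; rewrite indicE memNset ?mul0r// => tU; apply: tg.
  by rewrite /= -(gunitP tU) -(gunit_rng_dom tU) rt.
Qed.

Lemma bmul1l b : bmul (iA \1_(@gunits G)) b = b.
Proof.
have C1 := Cc_cob nG (cob_gunits nG) (R := R).
apply: (@eq_nrm_le _ _ (nrm (iA \1_(@gunits G)) + 1)) => e e0.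
have [f Cf hf] := Cc_dense FA b e0.
have -> : bmul (iA \1_(@gunits G)) b - b =
    bmul (iA \1_(@gunits G)) (b - iA f) + (iA f - b).
  by rewrite bmulBr -(Fp_mul FA)// convol1l addrA subrK.
rewrite (le_trans (ler_nrmD _ _))// mulrDl mul1r lerD//.
  by rewrite (le_trans (nrm_bmul _ _))// ler_wpM2l ?nrm_ge0 ?ltW.
by rewrite nrmBC ltW.
Qed.

Lemma bmul1r b : bmul b (iA \1_(@gunits G)) = b.
Proof.
have C1 := Cc_cob nG (cob_gunits nG) (R := R).
apply: (@eq_nrm_le _ _ (nrm (iA \1_(@gunits G)) + 1)) => e e0.
have [f Cf hf] := Cc_dense FA b e0.
have -> : bmul b (iA \1_(@gunits G)) - b =
    bmul (b - iA f) (iA \1_(@gunits G)) + (iA f - b).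
  by rewrite bmulBl -(Fp_mul FA)// (convolr1 nG) addrA subrK.
rewrite (le_trans (ler_nrmD _ _))// mulrDl mul1r lerD//.
  by rewrite (le_trans (nrm_bmul _ _))// mulrC ler_wpM2l ?nrm_ge0 ?ltW.
by rewrite nrmBC ltW.
Qed.

End Coefficients.

Lemma ginv_unit (G : groupoidType) (g : G) : @gunits G g -> ginv g = g.
Proof.
move=> /gunitP <-; rewrite -[LHS]gmul1g grng_inv gdom_unit.
by rewrite gmulgV grng_unit.
Qed.

(** The roots are 1/2 and 1/(1 - i) = (1 + i)/2. *)
Lemma no_common_root (R : rcfType) (z : R[i]) :
  1 - 2 * z = 0 -> 1 + ('i - 1)%C * z = 0 -> False.
Proof.
case: z => x y /eqP; rewrite eq_complex/= => /andP[/eqP h1 /eqP h2] /eqP.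
rewrite eq_complex/= => /andP[/eqP h3 /eqP h4]; lra.
Qed.

Lemma gmul_unitV (G : groupoidType) (g : G) :
  gmul g (ginv (set_val (gdom g))) = g.
Proof. by rewrite -{1}(gmulg1 g) gmulK// grng_unit. Qed.

(** * Invertible isometries *)

Section Lamperti.
Context {R : realType} (p : R).
Hypothesis (p1 : 1 <= p) (p2 : p != 2).
Context {G : topGroupoidType}.
Hypothesis nG : @ample_weyl G.
Context {A : banachAlgType R[i]} (iA : (G -> R[i]) -> A).
Hypothesis FA : is_Fp_lambda p iA.
Implicit Types (x : unit_space G) (a b c d e : A) (g k t : G).

Local Notation coef := (coef iA).
Local Notation one := (iA \1_(@gunits G)).

Definition isom_pair b b' :=
  [/\ bmul b b' = one, bmul b' b = one, nrm b <= 1 & nrm b' <= 1].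

Lemma isom_pair_sym b b' : isom_pair b b' -> isom_pair b' b.
Proof. by case. Qed.

Lemma isom_pair_mul b b' c c' : isom_pair b b' -> isom_pair c c' ->
  isom_pair (bmul b c) (bmul c' b').
Proof.
have h (u v : A) : nrm u <= 1 -> nrm v <= 1 -> nrm (bmul u v) <= 1.
  move=> u1 v1; rewrite (le_trans (nrm_bmul _ _))//.
  by rewrite mulr_ile1 ?nrm_ge0.
move=> [bb' b'b b1 b'1] [cc' c'c c1 c'1]; split; rewrite ?h//.
  by rewrite -bmulA (bmulA c) cc' (bmul1l nG FA) bb'.
by rewrite -bmulA (bmulA b') b'b (bmul1l nG FA) c'c.
Qed.

Lemma isom_pairK b b' c : isom_pair b b' -> bmul b' (bmul b c) = c.
Proof. by move=> [_ b'b _ _]; rewrite bmulA b'b (bmul1l nG FA). Qed.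

Lemma coef1 g : coef one g = \1_(@gunits G) g.
Proof. by rewrite (coef_iA p1 nG FA)//; apply: (Cc_cob nG); exact: cob_gunits. Qed.

Lemma psum_contract x b c : nrm b <= 1 ->
  (psum p (dfiber x) (coef (bmul b c)) <= psum p (dfiber x) (coef c))%E.
Proof.
move=> b1; have p0 : 0 < p by rewrite (lt_le_trans _ p1).
have := ple_coef p1 nG FA x c; rewrite /ple => S1.
have S0 := psum_ge0 p x (coef c).
have Sf : (psum p (dfiber x) (coef c) \is a fin_num)%E.
  by rewrite ge0_fin_numE// (le_lt_trans S1)// ltry.
pose m := fine (psum p (dfiber x) (coef c)) `^ p^-1.
have mp : ((m `^ p)%:E = psum p (dfiber x) (coef c))%E.
  by rewrite /m -powRrM mulVf ?gt_eqF// powRr1 ?fine_ge0// fineK.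
have m0 : 0 <= m by exact: powR_ge0.
have cm : ple p (dfiber x) (coef c) m by rewrite /ple mp.
rewrite -mp; apply: (ple_le p1 _ _ (ple_coef_bmul p1 nG FA b m0 cm)).
  by rewrite mulr_ge0// nrm_ge0.
by rewrite ler_piMl.
Qed.

Lemma psum_isom x b b' c : isom_pair b b' ->
  psum p (dfiber x) (coef (bmul b c)) = psum p (dfiber x) (coef c).
Proof.
move=> bb; have [_ _ b1 b'1] := bb; apply/le_anti/andP; split.
  exact: psum_contract.
rewrite -{1}(isom_pairK c bb); exact: psum_contract.
Qed.

(** Disjointness on a fibre is equality in Clarkson's inequality, which involves only the norms of
    the columns of c, d, c + d and c - d; [b] preserves all four. *)
Lemma isom_disjoint x b b' c d : isom_pair b b' ->
    (forall g, gdom g = x -> coef c g = 0 \/ coef d g = 0) ->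
  forall g, gdom g = x -> coef (bmul b c) g = 0 \/ coef (bmul b d) g = 0.
Proof.
move=> bb cd; have cx := ple_coef p1 nG FA x.
apply: (disjoint_of_clarkson p1 p2 (cx _) (cx _)).
have := clarkson_of_disjoint p1 cd.
have E1 u v : psum p (dfiber x) (fun t => coef u t + coef v t) =
    psum p (dfiber x) (coef (u + v)).
  by apply: eq_psum => t _; rewrite (coefD p1 nG FA).
have E2 u v : psum p (dfiber x) (fun t => coef u t - coef v t) =
    psum p (dfiber x) (coef (u - v)).
  by apply: eq_psum => t _; rewrite (coefB p1 nG FA).
rewrite E1 E2 => h; rewrite E1 E2 -bmulDr -bmulBr.
rewrite (psum_isom x c bb) (psum_isom x d bb) (psum_isom x (c + d) bb).
by rewrite (psum_isom x (c - d) bb); exact: h.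
Qed.

Lemma coef_bmul_eq0 x b c : (forall g, gdom g = x -> coef c g = 0) ->
  forall g, gdom g = x -> coef (bmul b c) g = 0.
Proof.
move=> c0 g gx; have -> : 0 = coef (bmul b 0) g by rewrite bmulr0 (coef0 p1 nG FA).
apply: (@coef_bmul_fiber _ _ p1 _ nG _ _ FA x) => // t /c0 ->.
by rewrite (coef0 p1 nG FA).
Qed.

(* Banach-Lamperti: for p <> 2, a surjective isometry of l^p(Gx) preserves
   disjointness of supports, so the image of a point mass is a multiple of a
   point mass. *)
Lemma lamperti_ex x b b' : isom_pair b b' -> exists2 k, gdom k = x & coef b k != 0.
Proof.
move=> [_ b'b _ _]; apply: contrapT => /forall2NP nk.
have : coef one (set_val x) = 0.
  rewrite -b'b; apply: (@coef_bmul_eq0 x); last exact: gdom_unit.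
  by move=> g gx; case: (nk g) => // /negP; rewrite negbK => /eqP.
rewrite coef1 indicE mem_set; last exact: gunits_val.
by move/eqP; rewrite oner_eq0.
Qed.

(** On the fibre split b into its part c at k and the rest d. Then b'c and b'd have disjoint
    supports and add up to the point mass at x, so one of them vanishes on the fibre; applying b, so
    does c or d, although c is nonzero at k and d at t. *)
Lemma lamperti_uniq b b' k t : isom_pair b b' -> gdom k = gdom t ->
  coef b k != 0 -> coef b t != 0 -> k = t.
Proof.
move=> bb kt bk bt; apply/eqP/negPn/negP => nkt; set x := gdom t.
have [W [cW Wk _]] := cob_nbhs nG openT (I : [set: G] k).
have CW := Cc_cob nG cW (R := R); have [_ _ dW _] := cW.
pose c := coef b k *: iA \1_W; pose d := b - c.
have ck : coef c k = coef b k.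
  by rewrite /c (coefZ p1 nG FA) (coef_iA p1 nG FA)// indicE mem_set// mulr1.
have c0 g : gdom g = x -> g != k -> coef c g = 0.
  move=> gx /eqP gk; rewrite /c (coefZ p1 nG FA) (coef_iA p1 nG FA)// indicE.
  rewrite memNset ?mulr0// => Wg; apply: gk; apply: (dW g k (mem_set Wg) (mem_set Wk)).
  by rewrite gx kt.
have dk : coef d k = 0 by rewrite (coefB p1 nG FA) ck subrr.
have dt : coef d t = coef b t.
  by rewrite (coefB p1 nG FA) c0 ?subr0// eq_sym.
have disj : forall g, gdom g = x ->
    coef (bmul b' c) g = 0 \/ coef (bmul b' d) g = 0.
  apply: (isom_disjoint (isom_pair_sym bb)) => g gx.
  by have [->|/(c0 g gx) ->] := eqVneq g k; [right|left].
have sum1 g : coef (bmul b' c) g + coef (bmul b' d) g = \1_(@gunits G) g.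
  rewrite -(coefD p1 nG FA) -bmulDr /d addrC subrK.
  by have [_ -> _ _] := bb; exact: coef1.
have off g : gdom g = x -> g != set_val x ->
    coef (bmul b' c) g = 0 /\ coef (bmul b' d) g = 0.
  move=> gx gu; have := sum1 g; rewrite indicE memNset; last first.
    by move=> /gunitP e; move: gu; rewrite -e gx eqxx.
  by case: (disj g gx) => ->; rewrite ?add0r ?addr0.
have back u : bmul b (bmul b' u) = u by exact: isom_pairK (isom_pair_sym bb).
have ux : gdom (set_val x) = x by exact: gdom_unit.
case: (disj _ ux) => h0.
  have h g : gdom g = x -> coef (bmul b' c) g = 0.
    by move=> gx; have [->//|/(off g gx) []] := eqVneq g (set_val x).
  have := coef_bmul_eq0 b h kt; rewrite back ck => e.
  by rewrite e eqxx in bk.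
have h g : gdom g = x -> coef (bmul b' d) g = 0.
  by move=> gx; have [->//|/(off g gx) []] := eqVneq g (set_val x).
have := coef_bmul_eq0 b h (erefl x); rewrite back dt => e.
by rewrite e eqxx in bt.
Qed.

Lemma isom_col b b' c k g : isom_pair b b' -> coef b k != 0 -> gdom g = gdom k ->
  coef (bmul c b) g = coef c (gmul g (ginv k)) * coef b k.
Proof.
move=> bb bk gk; apply: (coef_bmul_col p1 nG FA) => // t tk /eqP ntk.
apply/eqP/negPn/negP => bt; apply: ntk; exact: lamperti_uniq bb tk bt bk.
Qed.

(** Evaluating b'b = 1 at the unit d(g), where the product reduces to one term, gives b'(g^-1) b(g)
    = 1. *)
Lemma isom_inv b b' g : isom_pair b b' -> coef b g != 0 -> coef b' (ginv g) != 0.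
Proof.
move=> bb bg; have [_ b'b _ _] := bb.
have := isom_col b' bb bg (gdom_unit (gdom g)); rewrite b'b coef1 indicE mem_set; last first.
  exact: gunits_val.
have -> : gmul (set_val (gdom g)) (ginv g) = ginv g by rewrite -grng_inv gmul1g.
by move=> h; apply/eqP => e; move/eqP: h; rewrite e mul0r oner_eq0.
Qed.

(** For an isometry pair the support of [coef b] has exactly one point over x, so the default
    [set_val x] is not reached. *)
Definition isom_act b x : unit_space G :=
  grng (xget (set_val x) [set k | gdom k = x /\ coef b k != 0]).

Lemma isom_actE b b' g : isom_pair b b' -> coef b g != 0 ->
  isom_act b (gdom g) = grng g.
Proof.
move=> bb bg; rewrite /isom_act; congr grng.
case: xgetP => [k -> [kg bk]|/(_ g) []//].
exact: lamperti_uniq bb kg bk bg.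
Qed.

Lemma isom_act_full b b' : isom_pair b b' -> @full_group G (isom_act b).
Proof.
move=> bb; have bb' := isom_pair_sym bb; exists [set g | coef b g != 0]; split.
- split; first exact: (open_coef_neq0 p1 nG FA).
  (* Inverses of points in the support of b lie in the support of b', which turns injectivity of the
     range into injectivity of the domain. *)
  + move=> g h; rewrite !inE/= => bg bh e.
    apply: (can_inj (@ginvK G)); apply: (lamperti_uniq bb').
    * by rewrite !gdom_inv.
    * exact: isom_inv bb bg.
    * exact: isom_inv bb bh.
  + by move=> g h; rewrite !inE/= => bg bh e; exact: lamperti_uniq bb e bg bh.
- apply/seteqP; split => // x _; have [k kx bk] := lamperti_ex x bb.
  by exists k.
- apply/seteqP; split => // x _; have [k kx bk] := lamperti_ex x bb'.
  by exists (ginv k); rewrite ?grng_inv//=; exact: isom_inv bb' bk.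
- by move=> g bg; exact: isom_actE bb bg.
Qed.

Lemma isom_act_mul b b' c c' : isom_pair b b' -> isom_pair c c' ->
  isom_act (bmul b c) = isom_act b \o isom_act c.
Proof.
move=> bb cc; apply/funext => x /=.
have [k <- ck] := lamperti_ex x cc.
have [l lk bl] := lamperti_ex (grng k) bb.
rewrite (isom_actE cc ck) -lk (isom_actE bb bl).
rewrite -(gdom_mul l k lk) -(grng_mul l k lk); apply: (isom_actE (isom_pair_mul bb cc)).
by rewrite (isom_col _ cc ck) ?gdom_mul// gmulK// mulf_neq0.
Qed.

(** The support of b is then an open subset of the isotropy, and effectiveness applies in this
    form. *)
Lemma isom_act_id b b' g : isom_pair b b' -> isom_act b =1 id ->
  coef b g != 0 -> @gunits G g.
Proof.
move=> bb bid bg; rewrite -(ample_weyl_effective nG).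
have : nbhs g [set g | coef b g != 0].
  by apply: open_nbhs_nbhs; split => //; exact: (open_coef_neq0 p1 nG FA).
apply: filterS => t bt /=; by rewrite -(isom_actE bb bt) bid.
Qed.

Lemma diag_of_isom e b b' c c' g : b = one - 2 *: e -> c = one + ('i - 1)%C *: e ->
  isom_pair b b' -> isom_pair c c' -> coef e g != 0 -> @gunits G g.
Proof.
move=> bE cE bb cc eg; apply: contrapT => ng; pose u : G := set_val (gdom g).
have ug : gdom u = gdom g by rewrite gdom_unit.
have nug : u <> g by move=> e1; apply: ng; rewrite -e1; exact: gunits_val.
have g0 : coef one g = 0 by rewrite coef1 indicE memNset.
have u1 : coef one u = 1 by rewrite coef1 indicE mem_set//; exact: gunits_val.
have zero d d' : isom_pair d d' -> coef d g != 0 -> coef d u = 0.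
  move=> dd dg; apply/eqP/negPn/negP => du; apply: nug.
  exact: lamperti_uniq dd ug du dg.
have h1 : coef b u = 0.
  apply: (zero _ _ bb); rewrite bE (coefB p1 nG FA) (coefZ p1 nG FA) g0 sub0r oppr_eq0.
  by rewrite mulf_neq0// pnatr_eq0.
have h2 : coef c u = 0.
  apply: (zero _ _ cc); rewrite cE (coefD p1 nG FA) (coefZ p1 nG FA) g0 add0r mulf_neq0//.
  by apply/eqP => /(congr1 (@complex.Im R))/=/eqP; rewrite subr0 oner_eq0.
move: h1 h2; rewrite bE cE (coefB p1 nG FA) (coefD p1 nG FA) !(coefZ p1 nG FA) u1.
exact: no_common_root.
Qed.

Lemma diag_conj b b' e : isom_pair b b' -> (forall g, coef b g != 0 -> @gunits G g) ->
  (forall g, coef e g != 0 -> @gunits G g) -> bmul (bmul b e) b' = e.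
Proof.
move=> bb bu eu; apply: (coef_inj p1 nG FA); apply/funext => g.
have b'u k : coef b' k != 0 -> @gunits G k.
  move=> /(isom_inv (isom_pair_sym bb)) /bu ku.
  by rewrite -(ginvK k) (ginv_unit ku).
(* An element supported in the units has multiples of unit point masses as columns, so right
   multiplication by it rescales coefficients pointwise. *)
have diag c d k : (forall k, coef d k != 0 -> @gunits G k) ->
    coef (bmul c d) k = coef c k * coef d (set_val (gdom k)).
  move=> du; rewrite (@coef_bmul_col _ _ p1 _ nG _ _ FA c d (set_val (gdom k)))//.
  - by rewrite gmul_unitV.
  - by rewrite gdom_unit.
  - move=> t; rewrite gdom_unit => tk ntk; apply/eqP/negPn/negP => /du /gunitP.
    by rewrite tk => e1; move: ntk; rewrite e1 eqxx.
(* Exchanging the scalar factors from e and b' turns b e b' into b b' e. *)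
rewrite !diag// mulrAC -diag//; have [-> _ _ _] := bb; rewrite coef1 indicE.
have [gu|gu] := pselect (@gunits G g); first by rewrite mem_set// mul1r gunitP.
rewrite memNset// mul0r; apply/eqP; rewrite eq_sym; apply/negPn/negP => /eu.
by [].
Qed.

End Lamperti.

(** * Full bisections *)

Section FullBisections.
Context {G : topGroupoidType}.
Implicit Types (S T W : set G) (g s t : G).

Definition full_bisection S :=
  [/\ open_bisection S, @gdom G @` S = setT & @grng G @` S = setT].

Definition setmul S T : set G :=
  [set gmul st.1 st.2 | st in [set st | [/\ S st.1, T st.2 & gdom st.1 = grng st.2]]].

Definition setinv S : set G := @ginv G @^-1` S.

Lemma mem_setmul S T s t : S s -> T t -> gdom s = grng t -> setmul S T (gmul s t).
Proof. by move=> Ss Tt e; exists (s, t). Qed.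

Lemma full_gdom S x : full_bisection S -> exists2 s, S s & gdom s = x.
Proof. by move=> [_ e _]; have : (@gdom G @` S) x by rewrite e. Qed.

Lemma full_grng S x : full_bisection S -> exists2 s, S s & grng s = x.
Proof. by move=> [_ _ e]; have : (@grng G @` S) x by rewrite e. Qed.

Lemma full_gdom_inj S s t : full_bisection S -> S s -> S t ->
  gdom s = gdom t -> s = t.
Proof. by move=> [[_ _ h] _ _] Ss St; apply: h; exact: mem_set. Qed.

Lemma full_grng_inj S s t : full_bisection S -> S s -> S t ->
  grng s = grng t -> s = t.
Proof. by move=> [[_ h _] _ _] Ss St; apply: h; exact: mem_set. Qed.

Lemma setinvK S : setinv (setinv S) = S.
Proof. by apply/seteqP; split => g; rewrite /setinv/= ginvK. Qed.

Lemma full_setinv S : full_bisection S -> full_bisection (setinv S).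
Proof.
move=> fS; have [[oS _ _] _ _] := fS; split; first split.
- by apply: open_comp => // g _; exact: ginv_continuous.
- move=> s t; rewrite !inE => Ss St e; apply: (can_inj (@ginvK G)).
  by apply: (full_gdom_inj fS) => //; rewrite !gdom_inv.
- move=> s t; rewrite !inE => Ss St e; apply: (can_inj (@ginvK G)).
  by apply: (full_grng_inj fS) => //; rewrite !grng_inv.
- apply/seteqP; split=> // x _; have [s Ss <-] := full_grng x fS.
  by exists (ginv s); rewrite ?gdom_inv// /setinv/= ginvK.
- apply/seteqP; split=> // x _; have [s Ss <-] := full_gdom x fS.
  by exists (ginv s); rewrite ?grng_inv// /setinv/= ginvK.
Qed.

Lemma setmulV S : full_bisection S -> setmul S (setinv S) = @gunits G.
Proof.
move=> fS; apply/seteqP; split=> [_ [[s t] /= [Ss St e] <-]|g gU].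
  have -> : t = ginv s.
    rewrite -(ginvK t); congr ginv; apply: (full_gdom_inj fS) => //.
    by rewrite gdom_inv.
  by rewrite gmulgV; exact: gunits_val.
have [s Ss sg] := full_grng (gdom g) fS.
rewrite -(gunitP gU) -sg -gmulgV; apply: mem_setmul => //.
  by rewrite /setinv/= ginvK.
by rewrite grng_inv.
Qed.

(** Openness of the product is assumed here; [full_setmul] derives it from the support of a
    coefficient function. *)
Lemma full_setmul_inj S T : full_bisection S -> full_bisection T ->
  open (setmul S T) -> full_bisection (setmul S T).
Proof.
move=> fS fT oST; split; first split => //.
- move=> _ _ /set_mem[[s t] /= [Ss Tt st] <-] /set_mem[[s' t'] /= [Ss' Tt' st'] <-].
  rewrite !grng_mul// => e; have ss := full_grng_inj fS Ss Ss' e.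
  rewrite -ss; congr (gmul s _); apply: (full_grng_inj fT) => //.
  by rewrite -st -st' ss.
- move=> _ _ /set_mem[[s t] /= [Ss Tt st] <-] /set_mem[[s' t'] /= [Ss' Tt' st'] <-].
  rewrite !gdom_mul// => e; have tt := full_gdom_inj fT Tt Tt' e.
  rewrite -tt; congr (gmul _ t); apply: (full_gdom_inj fS) => //.
  by rewrite st st' tt.
- apply/seteqP; split=> // x _; have [t Tt <-] := full_gdom x fT.
  have [s Ss st] := full_gdom (grng t) fS.
  by exists (gmul s t); [exact: mem_setmul|rewrite gdom_mul].
- apply/seteqP; split=> // x _; have [s Ss <-] := full_grng x fS.
  have [t Tt st] := full_grng (gdom s) fT.
  by exists (gmul s t); [exact: mem_setmul|rewrite grng_mul].
Qed.

Hypothesis nG : @ample_weyl G.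

Lemma full_gunits : full_bisection (@gunits G).
Proof.
have [_ oU dU rU] := cob_gunits nG; split => //.
- apply/seteqP; split=> // x _; exists (set_val x); first exact: gunits_val.
  exact: gdom_unit.
- apply/seteqP; split=> // x _; exists (set_val x); first exact: gunits_val.
  exact: grng_unit.
Qed.

(** S is the image of the compact unit space under the inverse of [gdom] on S, which is continuous
    because [gdom] is open. *)
Lemma full_cob S : full_bisection S -> compact_bisection S.
Proof.
move=> fS; have [[oS rS dS] _ _] := fS; split => //.
pose s x := projT1 (cid2 (full_gdom x fS)).
have sS x : S (s x) by rewrite /s; case: cid2.
have ds x : gdom (s x) = x by rewrite /s; case: cid2.
have -> : S = s @` setT.
  apply/seteqP; split=> [g Sg|_ [x _ <-]//]; exists (gdom g) => //.
  by apply: (full_gdom_inj fS).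
apply: continuous_compact; last by case: nG.
apply: continuous_subspaceT => x O nO.
have : nbhs (s x) (O `&` S) by apply: filterI nO _; exact: open_nbhs_nbhs.
rewrite nbhsE => -[V [oV Vx] VO].
have : nbhs x (@gdom G @` V).
  by apply: open_nbhs_nbhs; split; [exact: gdom_open|exists (s x)].
apply: filterS => y [g /VO[Og Sg] <-] /=.
by rewrite (_ : s (gdom g) = g)//; apply: (full_gdom_inj fS).
Qed.

(* The product of two open bisections that implement the same map lies in the
   isotropy, hence in the unit space by effectiveness. *)
Lemma full_bisection_uniq S T (a : unit_space G -> unit_space G) :
    full_bisection S -> full_bisection T -> open (setmul S (setinv T)) ->
    (forall g, S g -> a (gdom g) = grng g) ->
    (forall g, T g -> a (gdom g) = grng g) -> S `<=` T.
Proof.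
move=> fS fT oST aS aT s Ss; have [t Tt ts] := full_gdom (gdom s) fT.
have Vst : setmul S (setinv T) (gmul s (ginv t)).
  by apply: mem_setmul; rewrite /setinv/= ?ginvK ?grng_inv.
have : @gunits G (gmul s (ginv t)).
  rewrite -(ample_weyl_effective nG).
  have : nbhs (gmul s (ginv t)) (setmul S (setinv T)) by exact: open_nbhs_nbhs.
  apply: filterS => _ [[s' t'] /= [Ss' Tt' e] <-].
  rewrite grng_mul// gdom_mul// -aS// e -gdom_inv aT// grng_inv.
  by [].
move=> /gunitP; rewrite gdom_div// => e.
by rewrite -(gmulVK (esym ts)) -e gmul1g.
Qed.

End FullBisections.

(** * Convolution with indicators of bisections *)

Section Indicators.
Context {R : realType} {G : topGroupoidType}.
Implicit Types (S T W : set G) (f xi : G -> R[i]).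

Lemma convol_indic S T : set_inj S (@grng G) ->
  convol (\1_S : G -> R[i]) \1_T = \1_(setmul S T).
Proof.
move=> rS; apply/funext => g; rewrite [RHS]indicE.
have [[[s t] /= [Ss Tt e] <-]|ng] := pselect (setmul S T g).
  rewrite mem_set; last exact: mem_setmul.
  rewrite /convol grng_mul// -(@fsbig_widen _ _ _ _ [set s]).
  - by rewrite fsbig_set1 gmulKg// !indicE !mem_set// mulr1.
  - by move=> _ ->.
  - move=> u [/= ru us]; rewrite indicE memNset ?mul0r// => Su; apply: us.
    by apply: rS; rewrite ?inE// ru.
rewrite memNset// /convol fsbig1// => t rt; rewrite !indicE.
have [St|St] := pselect (S t); last by rewrite memNset// mul0r.
rewrite [_ \in T]memNset ?mulr0// => Tt; apply: ng.
by rewrite -(gmulKV rt); apply: mem_setmul => //; rewrite grng_ldiv.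
Qed.

Lemma convol_suppl1 S f xi g t : set_inj S (@grng G) ->
    (forall t, f t != 0 -> S t) -> S t -> grng t = grng g ->
  convol f xi g = f t * xi (gmul (ginv t) g).
Proof.
move=> rS fS St tg; rewrite /convol -(@fsbig_widen _ _ _ _ [set t]) ?fsbig_set1//.
  by move=> _ ->.
move=> u [/= ru us]; have [->|/fS Su] := eqVneq (f u) 0; first by rewrite mul0r.
by case: us; apply: rS; rewrite ?inE// ru tg.
Qed.

End Indicators.

(** * Invertible isometries coming from full bisections *)

Section FullElements.
Context {R : realType} (p : R).
Hypothesis p1 : 1 <= p.
Context {G : topGroupoidType}.
Hypothesis nG : @ample_weyl G.
Context {A : banachAlgType R[i]} (iA : (G -> R[i]) -> A).
Hypothesis FA : is_Fp_lambda p iA.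
Implicit Types (S T W : set G) (f xi : G -> R[i]).

Local Notation one := (iA \1_(@gunits G)).

(* On l^p(Gx) such a function acts as a permutation followed by a
   multiplication. *)
Lemma nrm_full_le1 S f : full_bisection S -> Cc f -> (forall t, f t != 0 -> S t) ->
  (forall t, nrm (f t) <= 1) -> nrm (iA f) <= 1.
Proof.
move=> fS Cf suppf f1; have [[oS rS dS] _ _] := fS.
have p0 : 0 <= p by rewrite (le_trans _ p1).
rewrite -lee_fin [X in (X <= _)%E](Fp_isometric FA Cf) /reduced_norm ge_max.
rewrite lee_fin ler01/=; apply: ge_ereal_sup => _ [x _ <-].
apply: ge_ereal_sup => _ [xi [_ /= xi1] <-].
apply/(lpnorm_leP p1); first exact: ler01.
move/(lpnorm_leP p1 _ _ ler01) : xi1 => /pleP xi1.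
(* (f * xi)(g) is the single term f(t) xi(t^-1 g), with t the point of S of range r(g); the map g to
   t^-1 g is injective, so it carries [r] to a duplicate-free list. *)
pose t g := projT1 (cid2 (full_grng (grng g) fS)).
have tS g : S (t g) by rewrite /t; case: cid2.
have rt g : grng (t g) = grng g by rewrite /t; case: cid2.
pose sg g := gmul (ginv (t g)) g.
apply/pleP => r ur rx.
have usg : uniq [seq sg g | g <- r].
  rewrite map_inj_in_uniq// => g h gr hr e.
  have tt : t g = t h.
    apply: (full_gdom_inj fS) => //.
    by rewrite -(grng_ldiv (rt g)) -(grng_ldiv (rt h)) [gmul _ _]e.
  by rewrite -(gmulKV (rt g)) -(gmulKV (rt h)) -/(sg g) -/(sg h) e tt.
have sgx u : u \in [seq sg g | g <- r] -> dfiber x u.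
  by move=> /mapP[g gr ->]; rewrite /dfiber/= gdom_ldiv//; exact: rx.
have := xi1 _ usg sgx; rewrite big_map; apply: le_trans; apply: ler_sum => g _.
apply: ge0_ler_powR; rewrite ?nnegrE ?nrm_ge0//.
by rewrite /lambda (convol_suppl1 xi rS suppf (tS g) (rt g)) nrmM ler_piMl ?nrm_ge0.
Qed.

Lemma Cc_full S : full_bisection S -> Cc (\1_S : G -> R[i]).
Proof. by move=> fS; apply: (Cc_cob nG); exact: full_cob. Qed.

Lemma Cc_setmul S T : set_inj S (@grng G) -> Cc (\1_S : G -> R[i]) ->
  Cc (\1_T : G -> R[i]) -> Cc (\1_(setmul S T) : G -> R[i]).
Proof. by move=> rS CS CT; rewrite -convol_indic//; exact: Cc_convol. Qed.

Lemma iA_setmul S T : set_inj S (@grng G) -> Cc (\1_S : G -> R[i]) ->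
  Cc (\1_T : G -> R[i]) -> bmul (iA \1_S) (iA \1_T) = iA \1_(setmul S T).
Proof. by move=> rS CS CT; rewrite -(Fp_mul FA)// convol_indic. Qed.

Lemma full_setmul S T : full_bisection S -> full_bisection T ->
  full_bisection (setmul S T).
Proof.
move=> fS fT; apply: full_setmul_inj => //; have [[_ rS _] _ _] := fS.
have := open_coef_neq0 p1 nG FA (iA \1_(setmul S T)).
rewrite (coef_iA p1 nG FA); last by apply: Cc_setmul => //; exact: Cc_full.
congr open; apply/seteqP; split=> g /=; rewrite indicE.
  by case: (boolP (g \in _)) => [/set_mem//|]; rewrite eqxx.
by move=> /mem_set ->; rewrite oner_eq0.
Qed.

Lemma indic_supp S t : (\1_S t : R[i]) != 0 -> S t.
Proof. by rewrite indicE; case: (boolP (t \in S)) => [/set_mem//|]; rewrite eqxx. Qed.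

Lemma nrm_indic_le1 S t : nrm (\1_S t : R[i]) <= 1.
Proof. by rewrite indicE; case: (t \in S); rewrite ?nrm1 ?nrm0. Qed.

Lemma full_isom S : full_bisection S ->
  isom_pair iA (iA \1_S) (iA \1_(setinv S)).
Proof.
move=> fS; have fV := full_setinv fS; have [[_ rS _] _ _] := fS.
have [[_ rV _] _ _] := fV; split.
- by rewrite iA_setmul// ?setmulV//; exact: Cc_full.
- have e : setmul (setinv S) S = @gunits G.
    by rewrite -[X in setmul _ X](setinvK S) setmulV.
  by rewrite iA_setmul// ?e//; exact: Cc_full.
- by apply: (nrm_full_le1 fS (Cc_full fS)); [exact: indic_supp|exact: nrm_indic_le1].
- by apply: (nrm_full_le1 fV (Cc_full fV)); [exact: indic_supp|exact: nrm_indic_le1].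
Qed.

Lemma setmul_idem W : W `<=` @gunits G -> setmul W W = W.
Proof.
move=> WU; apply/seteqP; split=> [_ [[s t] /= [Ws Wt e] <-]|g Wg].
  by rewrite -(gunitP (WU _ Ws)) e gmul1g.
have e : gmul g g = g by rewrite -{1}(gunitP (WU _ Wg)) -(gunit_rng_dom (WU _ Wg)) gmul1g.
by rewrite -e; apply: mem_setmul => //; rewrite gunit_rng_dom//; exact: WU.
Qed.

(** The element is the function equal to w on W and to 1 on the other units. The norm bounds on both
    w and its inverse w' force |w| = 1; the values used later are -1 and i. *)
Lemma unitary_isom W (w w' : R[i]) : compact_bisection W -> W `<=` @gunits G -> w * w' = 1 ->
    nrm w <= 1 -> nrm w' <= 1 ->
  isom_pair iA (one + (w - 1) *: iA \1_W) (one + (w' - 1) *: iA \1_W).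
Proof.
move=> cW WU ww w1 w'1; have CW := Cc_cob nG cW (R := R).
have [_ _ _ rW] := cW; have fU := full_gunits nG.
have CU := Cc_full fU; have [[_ rU _] _ _] := fU.
have wE v : one + (v - 1) *: iA \1_W =
    iA (fun g => (v - 1) * \1_W g + \1_(@gunits G) g).
  by rewrite (Fp_linear FA)// addrC.
have bound v : nrm v <= 1 -> nrm (one + (v - 1) *: iA \1_W) <= 1.
  move=> v1; rewrite wE; apply: (nrm_full_le1 fU); first exact: Cc_lin.
    move=> t; apply: contra_neqP => tU.
    by rewrite !indicE !memNset ?mulr0 ?addr0// => /WU.
  move=> t; rewrite !indicE; have [Wt|Wt] := pselect (W t).
    by rewrite !mem_set ?mulr1 ?subrK//; exact: WU.
  by rewrite [_ \in W]memNset// mulr0 add0r; case: (_ \in _); rewrite ?nrm1 ?nrm0.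
have mulE u v : u * v = 1 ->
    bmul (one + (u - 1) *: iA \1_W) (one + (v - 1) *: iA \1_W) = one.
  move=> uv; rewrite bmulDl !bmulDr !(bmul1l nG FA) -!bscaleAl (bmul1r nG FA).
  rewrite -!bscaleAr iA_setmul// setmul_idem// -addrA -scalerDr.
  rewrite (_ : (v - 1) *: iA \1_W + _ = 0) ?addr0//.
  rewrite -[X in _ *: (X + _)]scale1r -scalerDl (addrC 1) subrK scalerA -scalerDl.
  by rewrite mulrBl uv mul1r addrC addrA subrK subrr scale0r.
split; rewrite ?bound//; [exact: mulE|by apply: mulE; rewrite mulrC].
Qed.

End FullElements.

(** * The induced embedding of full groups *)

Section Embedding.
Context {R : realType} (p : R).
Hypothesis (p1 : 1 <= p) (p2 : p != 2).
Context {G H : topGroupoidType}.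
Hypothesis (nG : @ample_weyl G) (nH : @ample_weyl H).
Context {A B : banachAlgType R[i]}.
Context (iA : (G -> R[i]) -> A) (iB : (H -> R[i]) -> B).
Hypothesis (FA : is_Fp_lambda p iA) (FB : is_Fp_lambda p iB).
Variable phi : {linear A -> B}.
Hypothesis (phiM : algebra_hom phi) (phi1 : unital iA iB phi)
  (phi_le : contractive phi) (phi_inj : injective_on_C iA phi).
Implicit Types (S T W : set G) (a : unit_space G -> unit_space G).

Local Notation oneA := (iA \1_(@gunits G)).
Local Notation oneB := (iB \1_(@gunits H)).
Local Notation el S := (phi (iA \1_S)).

Let phi_isom b b' : isom_pair iA b b' -> isom_pair iB (phi b) (phi b').
Proof.
have le u : nrm (phi u) <= nrm u by rewrite -lecR -!nrmE; exact: phi_le.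
move=> [bb' b'b b1 b'1]; split.
- by rewrite -phiM bb' phi1.
- by rewrite -phiM b'b phi1.
- exact: le_trans (le _) b1.
- exact: le_trans (le _) b'1.
Qed.

Let el_isom S : full_bisection S -> isom_pair iB (el S) (el (setinv S)).
Proof. by move=> fS; apply: phi_isom; exact: (full_isom p1 nG FA fS). Qed.

Definition implements S a := full_bisection S /\ forall g, S g -> a (gdom g) = grng g.

Let full_groupP a : full_group a -> exists S, implements S a.
Proof. by move=> [S [oS dS rS aS]]; exists S; split. Qed.

(** Multiplicativity of the induced map rests on this: the bisection chosen for a composite must be
    the product of the chosen ones. *)
Let implements_uniq S T a : implements S a -> implements T a -> S = T.
Proof.
move=> [fS aS] [fT aT].
have op (U V : set G) : full_bisection U -> full_bisection V -> open (setmul U (setinv V)).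
  by move=> fU fV; have [[? _ _] _ _] := full_setmul p1 nG FA fU (full_setinv fV).
by apply/seteqP; split; apply: (full_bisection_uniq nG (a := a)) => //; exact: op.
Qed.

Let implements_comp S T a a' : implements S a -> implements T a' ->
  implements (setmul S T) (a \o a').
Proof.
move=> [fS aS] [fT aT]; split; first exact: (full_setmul p1 nG FA).
move=> _ [[s t] /= [Ss Tt e] <-].
by rewrite gdom_mul// grng_mul// aT// -e aS.
Qed.

Definition bisection_of a : set G := xget set0 [set S | implements S a].

Let bisection_ofP a : full_group a -> implements (bisection_of a) a.
Proof. by move=> /full_groupP[S aS]; rewrite /bisection_of; case: xgetP => [T -> //|/(_ S)]. Qed.

Let el_mul S T : full_bisection S -> full_bisection T ->
  el (setmul S T) = bmul (el S) (el T).
Proof.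
move=> fS fT; rewrite -phiM (iA_setmul FA)//; try exact: (Cc_full nG).
by case: fS => [[]].
Qed.

Definition induced_map a := isom_act iB (el (bisection_of a)).

Lemma induced_map_full a : full_group a -> full_group (induced_map a).
Proof.
move=> /bisection_ofP[fS _].
exact: (isom_act_full p1 p2 nH FB (el_isom fS)).
Qed.

Lemma induced_map_comp a a' : full_group a -> full_group a' ->
  induced_map (a \o a') = induced_map a \o induced_map a'.
Proof.
move=> fa fa'; have aS := bisection_ofP fa; have aT := bisection_ofP fa'.
have st := implements_comp aS aT; have [fS _] := aS; have [fT _] := aT.
have e : bisection_of (a \o a') = setmul (bisection_of a) (bisection_of a').
  apply: (implements_uniq _ st); rewrite /bisection_of.
  by case: xgetP => [T -> //|/(_ _ st)].
rewrite /induced_map e el_mul//.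
exact: (isom_act_mul p1 p2 nH FB (el_isom fS) (el_isom fT)).
Qed.

(* For a clopen set W of units, the projection phi(1_W) is a multiplication
   operator, since 1 - 2 phi(1_W) and 1 + (i - 1) phi(1_W) are invertible
   isometries. *)
Let coef_el_unit W g : compact_bisection W -> W `<=` @gunits G -> coef iB (el W) g != 0 ->
  @gunits H g.
Proof.
move=> cW WU; have phiE w : phi (oneA + w *: iA \1_W) = oneB + w *: el W.
  by rewrite linearD linearZ/= phi1.
have h1 := phi_isom (unitary_isom p1 nG FA cW WU (w := -1) (w' := -1) _ _ _).
have hi := phi_isom (unitary_isom p1 nG FA cW WU (w := 'i%C) (w' := - 'i%C) _ _ _).
rewrite !phiE in h1, hi.
apply: (diag_of_isom p1 p2 nH FB _ (erefl _) (h1 _ _ _) (hi _ _ _)).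
- by rewrite (_ : -1 - 1 = - 2 :> R[i]) ?scaleNr//; ring.
- by rewrite mulrNN mulr1.
- by rewrite nrmN nrm1.
- by rewrite nrmN nrm1.
- by rewrite mulrN -expr2 sqr_i opprK.
- by rewrite /nrm normc_def /= expr0n expr1n add0r sqrtr1.
- by rewrite nrmN /nrm normc_def /= expr0n expr1n add0r sqrtr1.
Qed.

Let isom_act_el1 : isom_act iB (el (@gunits G)) = id.
Proof.
have fU := full_gunits nG; apply/funext => x.
have := el_isom fU; rewrite phi1 => h.
rewrite -[in LHS](gdom_unit x) (isom_actE p1 p2 nH FB h) ?grng_unit//.
by rewrite (coef1 p1 nH FB) indicE mem_set ?oner_neq0//; exact: gunits_val.
Qed.

Let conj_el S T W : full_bisection S -> full_bisection T -> compact_bisection W ->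
    W `<=` @gunits G -> isom_act iB (el S) = isom_act iB (el T) ->
  bmul (bmul (el S) (el W)) (el (setinv S)) = bmul (bmul (el T) (el W)) (el (setinv T)).
Proof.
move=> fS fT cW WU act; have fS' := full_setinv fS; have fT' := full_setinv fT.
have iS := el_isom fS; have iT := el_isom fT; have iT' := isom_pair_sym iT.
have bb := isom_pair_mul nH FB iT' iS.
have act1 : isom_act iB (bmul (el (setinv T)) (el S)) =1 id.
  move=> x; rewrite (isom_act_mul p1 p2 nH FB iT' iS) act.
  rewrite -(isom_act_mul p1 p2 nH FB iT' iT); have [_ -> _ _] := iT.
  by rewrite -phi1 isom_act_el1.
(* With u = phi(1_T)^-1 phi(1_S), this says u phi(1_W) u^-1 = phi(1_W); conjugating by phi(1_T)
   yields the claim. *)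
have e := diag_conj p1 p2 nH FB bb
  (fun g => isom_act_id p1 p2 nH FB bb act1) (fun g => coef_el_unit cW WU).
rewrite -[in RHS]e !bmulA; have [-> _ _ _] := iT; rewrite (bmul1l nH FB).
by rewrite -!bmulA; have [-> _ _ _] := iT; rewrite (bmul1r nH FB).
Qed.

(** The conjugate S W S^-1, which for a set W of units is the image of W under the homeomorphism of
    S. *)
Let translate S W := setmul (setmul S W) (setinv S).

Let el_translate S W : full_bisection S -> compact_bisection W -> W `<=` @gunits G ->
  Cc (\1_(translate S W) : G -> R[i]) /\
  bmul (bmul (iA \1_S) (iA \1_W)) (iA \1_(setinv S)) = iA \1_(translate S W).
Proof.
move=> fS cW WU; have [[_ rS _] _ _] := fS.
have rSW : set_inj (setmul S W) (@grng G).
  move=> g h /set_mem[[s t] /= [Ss Wt st] <-] /set_mem[[s' t'] /= [Ss' Wt' st'] <-].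
  rewrite !grng_mul// => e; have ss := full_grng_inj fS Ss Ss' e.
  rewrite -(gunitP (WU _ Wt)) -(gunitP (WU _ Wt')) -!(gunit_rng_dom (WU _ _))//.
  by rewrite -st -st' ss.
have CS := Cc_full nG fS (R := R); have CV := Cc_full nG (full_setinv fS) (R := R).
have CW := Cc_cob nG cW (R := R); have CSW := Cc_setmul nG rS CS CW.
split; first exact: Cc_setmul.
by rewrite (iA_setmul FA)// (iA_setmul FA).
Qed.

Let translateE S a W x : implements S a -> W `<=` @gunits G ->
  translate S W (set_val x) <-> exists2 y, W (set_val y) & a y = x.
Proof.
move=> [fS aS] WU; split.
  move=> [[_ t] /= [[[s w] /= [Ss Ww sw] <-] St e] ex].
  have ws : set_val (gdom s) = w by rewrite sw (gunit_rng_dom (WU _ Ww)) gunitP//; exact: WU.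
  exists (gdom s); first by rewrite ws.
  rewrite aS// -(grng_unit x) -ex !grng_mul//.
move=> [y Wy <-]; have [s Ss sy] := full_gdom y fS.
rewrite -sy aS// -gmulgV; rewrite -{1}(gmulg1 s) sy.
apply: mem_setmul; last by rewrite gdom_mul ?grng_inv ?gdom_unit ?grng_unit.
  by apply: mem_setmul; rewrite ?grng_unit.
by rewrite /setinv/= ginvK.
Qed.

Let translate_unit S W : full_bisection S -> W `<=` @gunits G ->
  translate S W `<=` @gunits G.
Proof.
move=> fS WU _ [[_ t] /= [[[s w] /= [Ss Ww sw] <-] St e] <-].
have -> : gmul s w = s by rewrite -{2}(gmulg1 s) sw gunit_rng_dom ?gunitP//; exact: WU.
rewrite -(setmulV fS); apply: mem_setmul => //.
by move: e; rewrite gdom_mul// -(gunit_rng_dom (WU _ Ww)) -sw.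
Qed.

Let ext0_indic W : W `<=` @gunits G ->
  ext0 ((\1_W : G -> R[i]) \o set_val) = (\1_W : G -> R[i]).
Proof.
move=> WU; rewrite /ext0 -[LHS]/((valL_ 0 \o sigL (@gunits G)) \1_W) sigLK.
apply/funext => g; rewrite /patch; case: ifPn => // /negP gU.
by rewrite indicE memNset// => /WU /mem_set.
Qed.

(** Both translates are clopen sets of units, so their indicators come from C(G^(0)), where phi is
    injective. *)
Let iA_translate_inj S T W : full_bisection S -> full_bisection T -> compact_bisection W ->
    W `<=` @gunits G -> isom_act iB (el S) = isom_act iB (el T) ->
  translate S W = translate T W.
Proof.
move=> fS fT cW WU act; have [CS eS] := el_translate fS cW WU.
have [CT eT] := el_translate fT cW WU.
have := conj_el fS fT cW WU act; rewrite -!phiM eS eT => e.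
have mem (U : set G) : full_bisection U -> Cc (\1_(translate U W) : G -> R[i]) ->
    iA \1_(translate U W) \in [set iA (ext0 f) |
      f in [set f | continuous (f : unit_space G -> R[i]^o)]].
  move=> fU [cU _]; rewrite inE.
  exists ((\1_(translate U W) : G -> R[i]) \o set_val); last first.
    by rewrite ext0_indic//; exact: translate_unit.
  by move=> x; apply: continuous_comp; [exact: set_val_cont|exact: cU].
have /(iA_inj p1 nG FA CS CT) eST := phi_inj (mem _ fS CS) (mem _ fT CT) e.
apply/seteqP; split=> g Ug; apply: (@indic_supp R); [rewrite -eST|rewrite eST];
  by rewrite indicE mem_set// oner_neq0.
Qed.

Lemma induced_map_inj a a' : full_group a -> full_group a' ->
  induced_map a = induced_map a' -> a = a'.
Proof.
move=> fa fa' act; have aS := bisection_ofP fa; have aT := bisection_ofP fa'.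
have [fS _] := aS; have [fT aTE] := aT.
apply/funext => x; apply: contrapT => ne.
(* [y] is the preimage of [a x] under [a']. It differs from x, so some compact open W contains x and
   misses y. *)
have [t Tt ty] := full_grng (a x) fT; pose y := gdom t.
have a'y : a' y = a x by rewrite aTE.
have oO : open (@gunits G `&` ~` [set set_val y]).
  apply: openI; first exact: open_gunits.
  rewrite openC; apply: compact_closed; first exact: ample_weyl_hausdorff.
  exact: compact_set1.
have Ox : (@gunits G `&` ~` [set set_val y]) (set_val x).
  split; first exact: gunits_val.
  by move=> /unit_val_inj e; apply: ne; rewrite e a'y -e.
have [W [cW Wx WO]] := cob_nbhs nG oO Ox.
have WU : W `<=` @gunits G by move=> g /WO[].
have eW := iA_translate_inj fS fT cW WU act.
have : translate (bisection_of a) W (set_val (a x)).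
  by apply/(translateE _ aS WU); exists x.
(* Since a(W) = a'(W), the point [a x] equals [a' z] with z in W; injectivity of the range on T
   gives z = y, which W avoids. *)
rewrite eW => /(translateE _ aT WU)[z Wz az].
have [s Ts sz] := full_gdom z fT.
have st : s = t by apply: (full_grng_inj fT) => //; rewrite -aTE// sz az ty.
have [_] := WO _ Wz; apply; rewrite /= -sz st //.
Qed.

End Embedding.
Unset Implicit Arguments.

Theorem theorem3 (R : realType) (p : R) (hp1 : 1 <= p) (hp2 : p != 2)
  (G H : topGroupoidType)
  (ampleG : ample G) (weylG : weyl G) (WG : condition_W G)
  (ampleH : ample H) (weylH : weyl H) (WH : condition_W H)
  (A : banachAlgType R[i]) (iA : (G -> R[i]) -> A) (FA : is_Fp_lambda p iA)
  (B : banachAlgType R[i]) (iB : (H -> R[i]) -> B) (FB : is_Fp_lambda p iB) :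
  (exists phi : {linear A -> B},
     [/\ algebra_hom phi, unital iA iB phi, contractive phi &
         injective_on_C iA phi]) ->
  full_group_embeds G H.
Proof.
move=> [phi [phiM phi1 phi_le phi_inj]].
have nG : @ample_weyl G by split => //; case: WG.
have nH : @ample_weyl H by split => //; case: WH.
exists (induced_map iA iB phi); split.
- by move=> a fa; exact: (induced_map_full hp1 hp2 nG nH FA FB).
- by move=> a a' /set_mem fa /set_mem fa'; exact: (induced_map_comp hp1 hp2 nG nH FA FB).
- move=> a a' /set_mem fa /set_mem fa'.
  exact: (induced_map_inj hp1 hp2 nG nH FA FB phiM phi1 phi_le phi_inj fa fa').
Qed.
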